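(* Let $d, s, t$ be (fixed) positive integers with $1 \le s \le t$, let $D = \{ sd, (s+1)d, \dots, td \}$, and let $D_{\mathrm{even}}$ be the set of even elements of $D$. As $n \to \infty$, the following hold. (1) If $d$ is even, then $$f_D(n) = (1 + o(1)) \cdot \frac{1}{\binom{t}{|D_{\mathrm{even}}|}} \cdot \binom{2n/d}{|D_{\mathrm{even}}|} = (1 + o(1)) \cdot \frac{1}{\binom{t}{t-s+1}} \cdot \binom{2n/d}{t-s+1}.$$ (2) If $d$ is odd, then $$f_D(n) = (1 + o(1)) \cdot \frac{c}{\binom{\lfloor t/2 \rfloor}{|D_{\mathrm{even}}|}} \cdot \binom{n/d}{|D_{\mathrm{even}}|} = (1 + o(1)) \cdot \frac{c}{\binom{\lfloor t/2 \rfloor}{\lfloor t/2 \rfloor - \lceil s/2 \rceil + 1}} \cdot \binom{n/d}{\lfloor t/2 \rfloor - \lceil s/2 \rceil + 1},$$ where $c = 1$ if $st$ is even and $c = 2$ if $st$ is odd.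
   Context: Write $[n] = \{1, \dots, n\}$ and $A \bigtriangleup B = (A \setminus B) \cup (B \setminus A)$. For a set $D$ of positive integers, a family $\mathcal{F} \subseteq 2^{[n]}$ is a $D$-distance family if $|A \bigtriangleup B| \in D$ for every pair of distinct sets $A, B \in \mathcal{F}$ (not every element of $D$ needs to occur as a distance). $f_D(n)$ denotes the maximum size of a $D$-distance family $\mathcal{F} \subseteq 2^{[n]}$. For real $x$ and an integer $k \ge 0$, $\binom{x}{k} = x(x-1)\cdots(x-k+1)/k!$ (so $\binom{x}{0} = 1$). The parameters $d, s, t$ are fixed and $o(1)$ denotes a quantity tending to $0$ as $n \to \infty$. *)

(* Defs.v *)
From HB Require Import structures.
From mathcomp Require Import all_boot all_order all_algebra finmap.
From mathcomp Require Import all_classical all_reals all_analysis.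
Set Implicit Arguments.
Unset Strict Implicit.
Unset Printing Implicit Defensive.
Import Order.TTheory GRing.Theory Num.Theory.
Import numFieldNormedType.Exports.
Local Open Scope nat_scope.

Definition symdiff (T : finType) (A B : {set T}) : {set T} :=
  (A :\: B) :|: (B :\: A).

Definition distance_family (D : {pred nat}) (n : nat)
    (F : {set {set 'I_n}}) : bool :=
  [forall A in F, forall B in F, (A != B) ==> (#|symdiff A B| \in D)].

(* f_D(n), the ground set [n] being modelled by 'I_n. *)
Definition max_distance_family (D : {pred nat}) (n : nat) : nat :=
  \max_(F : {set {set 'I_n}} | distance_family D F) #|F|.

Definition dist_set (d s t : nat) : {fset nat} :=
  [fset i * d | i in index_iota s t.+1]%fset.

Definition even_part (D : {fset nat}) : {fset nat} :=
  [fset x in D | ~~ odd x]%fset.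

Local Open Scope ring_scope.

Definition rbinom (R : realType) (x : R) (k : nat) : R :=
  (\prod_(i < k) (x - i%:R)) / (k`!)%:R.

Local Open Scope classical_set_scope.

(* u n = (1 + o(1)) * v n as n -> oo. The identity is only required for large
   n, since v may vanish at finitely many n where u does not. *)
Definition asymp_eq (R : realType) (u v : nat -> R) : Prop :=
  exists e : nat -> R,
    e @ \oo --> (0 : R) /\ \forall n \near \oo, u n = (1 + e n) * v n.

(* Main.v *)
Require Import Defs.
From HB Require Import structures.
From mathcomp Require Import all_boot all_order all_fingroup all_algebra finmap.
From mathcomp Require Import all_classical all_reals all_analysis.
From mathcomp Require Import zify ring lra.
Set Implicit Arguments.
Unset Strict Implicit.
Unset Printing Implicit Defensive.
Import Order.TTheory GRing.Theory Num.Theory.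
Import numFieldNormedType.Exports.
Local Open Scope nat_scope.

(** Write the even distances as 2ei with s' <= i <= t', where e = d/2,
    s' = s, t' = t for d even and e = d, s' = uphalf s, t' = t./2 for d odd; let g(t') be the largest size
    of a family with these distances, and r = t' - s' + 1. Both halves of the
    proof show that g(t') is asymptotic to n^r / prod_(s' <= i <= t') (ei).

    Upper bound. Let w = et', half of the largest even distance. A w-star is a
    large set of members A for which the petals, the sets A + Z (symmetric
    difference with a centre Z), are pairwise disjoint and of size w. If a
    family contains a w-star, every member X misses some petal, so its distance
    to the owner of that petal is |X + Z| + w; hence X lies within w of Z
    ([even_star_ball]). Two members on the sphere of radius w whose differences
    from Z share a point x are at distance less than 2w, so at most g(t'-1)
    members pass through x, and counting incidences gives
    w g(t') <= (n + C) g(t'-1) ([ball_bound]). If there is no w-star, a random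
    selection keeps a positive proportion of the family and no pair at distance
    2w ([star_free_subfamily]), so the family has only O(g(t'-1)) members.
    Iterating ([even_recursion]) gives the bound ([even_distance_bound]).

    For odd d the members of even size and those of odd size form two families
    with even distances, whence a factor 2. If st is even the factor disappears
    ([odd_distance_bound1]): a class without a star is negligible, and when both
    classes have stars, either t is even and each class forces the other one
    into a smaller ball, or t is odd, the centres differ in exactly d points,
    and moving both centres to the empty set merges the classes, up to
    O(g(t'-1)) members, into one family with even distances.

    Lower bound. Cut n points into N = n/e blocks of size e; a family of
    t'-subsets of the blocks, any two meeting in fewer than r blocks, has the
    required distances ([packing_distance_family]). That such packings can be
    nearly perfect is the theorem of Rodl ([near_optimal_packing]). It is proved
    by amplification. Over the integers mod q, with q coprime to M!, take the
    polynomials of degree < r, and the same polynomials plus X^r, evaluated at M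
    points: two codes whose graphs meet in < r points within one code and in
    <= r points across codes ([polynomial_codes]). Copying an optimal packing of
    M points onto every graph of the first code keeps its density, delta say. If
    each copy is permuted at random, a block put on a graph of the second code
    has all its r-subsets uncovered with probability (1 - delta)^C(k, r), since
    these r-subsets lie on different graphs of the first code; such blocks can
    be added ([packing_improvement]). So a density bounded away from 1 could be
    multiplied by a fixed factor > 1 again and again, which is absurd.

    For d, s and t odd the two codes carry two packings meeting each other in <= r
    blocks; adding one further block to every set of the second packing makes
    the cross distances admissible odd multiples of d, which gives the factor 2
    ([packing_pair_distance_family]). *)

(** * Averaging over independent choices *)

(** Under a uniformly random [w], the item [i] is good with probability at least
    [(b / #|W|) ^ h], since only the at most [h] coordinates in [S i] matter and
    they are independent; some [w] attains the average. It is used twice: to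
    thin out a star-free family, and to permute the copies of a packing. *)
Lemma exists_good_choice (J W I : finType) (h b : nat) (F : {set I})
    (S : I -> {set J}) (B : I -> J -> {set W}) :
    0 < #|W| ->
    (forall i, i \in F -> #|S i| <= h) ->
    (forall i j, i \in F -> j \in S i -> b <= #|B i j|) -> b <= #|W| ->
  exists w : {ffun J -> W},
    b ^ h * #|F| <= #|W| ^ h * #|[set i in F | [forall j in S i, w j \in B i j]]|.
Proof.
move=> W0 hS hB bW.
have [w0 _] : exists w0 : W, true.
  by case: (pickP W) => [w0 _|/eq_card0 h0]; [exists w0|move: W0; rewrite h0].
pose good (w : {ffun J -> W}) := [set i in F | [forall j in S i, w j \in B i j]].
pose N := #|W| ^ #|J|.
have cardN : #|{ffun J -> W}| = N by rewrite card_ffun.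
(* Double counting: the sum over [w] of the numbers of good items. *)
have lb : N * (b ^ h * #|F|) <= \sum_(w : {ffun J -> W}) #|W| ^ h * #|good w|.
  rewrite -big_distrr /=.
  have -> : \sum_(w : {ffun J -> W}) #|good w|
    = \sum_(i in F) #|[set w : {ffun J -> W} | [forall j in S i, w j \in B i j]]|.
    transitivity (\sum_(w : {ffun J -> W}) \sum_(i in good w) 1).
      by apply: eq_bigr => w _; rewrite sum1_card.
    rewrite (exchange_big_dep (fun i => i \in F)) /=; last by move=> w i _; rewrite inE => /andP[].
    apply: eq_bigr => i iF; rewrite -sum1_card; apply: eq_bigl => w.
    by rewrite !inE iF.
  rewrite big_distrr /= mulnA mulnC -sum_nat_const; apply: leq_sum => i iF.
  pose G j : {set W} := if j \in S i then B i j else [set: W].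
  have -> : #|[set w : {ffun J -> W} | [forall j in S i, w j \in B i j]]| = \prod_j #|G j|.
    transitivity #|family (fun j => mem (G j))|; last first.
      by rewrite card_family foldrE big_image.
    rewrite cardsE; apply: eq_card => w.
    rewrite !inE; apply/forallP/forallP => /= H j; move: (H j); rewrite /G;
    case: (j \in S i) => //=; by rewrite inE.
  rewrite (bigID (mem (S i))) /=.
  have -> : \prod_(j | j \notin S i) #|G j| = #|W| ^ (#|J| - #|S i|).
    under eq_bigr => j jS do rewrite /G (negbTE jS) cardsT.
    by rewrite prod_nat_const -(cardC (mem (S i))) addKn.
  have hl : b ^ #|S i| <= \prod_(j in S i) #|G j|.
    rewrite -prod_nat_const; apply: leq_prod => j jS.
    by rewrite /G jS; apply: hB.
  have -> : N = #|W| ^ #|S i| * #|W| ^ (#|J| - #|S i|).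
    by rewrite -expnD subnKC // max_card.
  have e1 : b ^ h = b ^ #|S i| * b ^ (h - #|S i|) by rewrite -expnD subnKC // hS.
  have e2 : #|W| ^ h = #|W| ^ #|S i| * #|W| ^ (h - #|S i|) by rewrite -expnD subnKC // hS.
  have hr : b ^ (h - #|S i|) <= #|W| ^ (h - #|S i|) by case: (posnP (h - #|S i|)) => [->|e0]; rewrite ?expn0 ?leq_exp2r.
  rewrite e1 e2.
  have := leq_mul (leqnn (#|W| ^ #|S i| * #|W| ^ (#|J| - #|S i|))) (leq_mul hl hr).
  move: (#|W| ^ _) (#|W| ^ _) (#|W| ^ _) (b ^ _) (b ^ _) (\prod_(j in S i) _).
  by clear; move=> x1 x2 x3 x4 x5 x6; lia.
case: (pickP (fun w => b ^ h * #|F| <= #|W| ^ h * #|good w|)) => [w hw|no]; first by exists w.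
have ub : \sum_(w : {ffun J -> W}) #|W| ^ h * #|good w| + N <= N * (b ^ h * #|F|).
  rewrite -cardN -[X in _ + X]sum1_card -big_split /= -sum_nat_const.
  by apply: leq_sum => w _; rewrite addn1 ltnNge no.
have N0 : 0 < N by rewrite expn_gt0 W0.
by move: ub lb N0; lia.
Qed.

(** * Symmetric differences and distance families *)

Lemma in_symdiff (T : finType) (A B : {set T}) x :
  (x \in symdiff A B) = (x \in A) (+) (x \in B).
Proof. by rewrite /symdiff !inE; case: (x \in A); case: (x \in B). Qed.

Lemma symdiffC (T : finType) (A B : {set T}) : symdiff A B = symdiff B A.
Proof. by apply/finset.setP => x; rewrite !in_symdiff addbC. Qed.

Lemma symdiffA (T : finType) (A B C : {set T}) :
  symdiff A (symdiff B C) = symdiff (symdiff A B) C.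
Proof. by apply/finset.setP => x; rewrite !in_symdiff addbA. Qed.

Lemma symdiffK (T : finType) (C : {set T}) :
  involutive (fun A : {set T} => symdiff A C).
Proof. by move=> A; apply/finset.setP => x; rewrite !in_symdiff addbK. Qed.

(** Translation by [C] is an isometry of the cube, so a centre can always be
    moved to the empty set. *)
Lemma symdiff_shift (T : finType) (A B C : {set T}) :
  symdiff (symdiff A C) (symdiff B C) = symdiff A B.
Proof.
by rewrite -symdiffA (symdiffC C) -symdiffA [symdiff C C](_ : _ = finset.set0) ?symdiffA;
  apply/finset.setP => x; rewrite !(in_symdiff, inE) ?addbF ?addbb.
Qed.

Lemma card_symdiff (T : finType) (A B : {set T}) :
  #|symdiff A B| + 2 * #|A :&: B| = #|A| + #|B|.
Proof.
have : [disjoint A :\: B & B :\: A].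
  by apply/pred0P => x /=; rewrite !inE; case: (x \in A); case: (x \in B).
rewrite -leq_card_setU => /eqP; rewrite -/(symdiff A B) => ->.
have := cardsID B A; have := cardsID A B; rewrite (finset.setIC B A); lia.
Qed.

Lemma card_symdiff_disjoint (T : finType) (A B : {set T}) :
  [disjoint A & B] -> #|symdiff A B| = #|A| + #|B|.
Proof.
move=> dAB; have := card_symdiff A B.
by rewrite (finset.disjoint_setI0 dAB) cards0 muln0 addn0.
Qed.

Lemma card_symdiff_eq0 (T : finType) (A B : {set T}) :
  (#|symdiff A B| == 0) = (A == B).
Proof.
rewrite cards_eq0; apply/eqP/eqP => [h|->].
  apply/finset.setP => x; move/finset.setP: h => /(_ x); rewrite in_symdiff inE.
  by case: (x \in A); case: (x \in B).
by apply/finset.setP => x; rewrite in_symdiff inE addbb.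
Qed.

Lemma card_symdiff_triangle (T : finType) (C A B : {set T}) :
  #|symdiff A B| <= #|symdiff A C| + #|symdiff B C|.
Proof. by rewrite -(symdiff_shift A B C); have := card_symdiff (symdiff A C) (symdiff B C); lia. Qed.

Lemma odd_card_symdiff (T : finType) (A B : {set T}) :
  odd #|symdiff A B| = odd #|A| (+) odd #|B|.
Proof.
by rewrite -oddD -card_symdiff mul2n oddD odd_double addbF.
Qed.

Lemma leq_card_bigcup (I T : finType) (A : {set I}) (f : I -> {set T}) :
  #|\bigcup_(i in A) f i| <= \sum_(i in A) #|f i|.
Proof.
elim/big_rec2: _ => [|i n U _ leU]; first by rewrite cards0.
by apply: leq_trans (leq_add (leqnn _) leU); rewrite leq_card_setU.
Qed.

Lemma distance_familyP (D : {pred nat}) n (F : {set {set 'I_n}}) :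
  reflect {in F &, forall A B, A != B -> #|symdiff A B| \in D} (distance_family D F).
Proof.
apply: (iffP forall_inP) => [h A B AF BF AB|h A AF].
  by move/forall_inP: (h A AF) => /(_ B BF) /implyP; apply.
by apply/forall_inP => B BF; apply/implyP; apply: h.
Qed.

Lemma leq_max_distance_family (D : {pred nat}) n (F : {set {set 'I_n}}) :
  {in F &, forall A B, A != B -> #|symdiff A B| \in D} ->
  #|F| <= max_distance_family D n.
Proof. by move/distance_familyP => h; apply: leq_bigmax_cond. Qed.

Lemma max_distance_family_leq (D : {pred nat}) n m :
  (forall F : {set {set 'I_n}}, distance_family D F -> #|F| <= m) ->
  max_distance_family D n <= m.
Proof. by move=> h; apply/bigmax_leqP. Qed.

Lemma dist_setP d s t x :
  reflect (exists2 i, s <= i <= t & x = i * d) (x \in dist_set d s t).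
Proof.
rewrite /dist_set; apply: (iffP (imfsetP _ _ _ _)) => /= [[i + ->]|[i hi ->]]; last by exists i; rewrite // mem_index_iota.
by rewrite mem_index_iota ltnS => hi; exists i.
Qed.

(** * Stars *)

(** The petals are the sets [symdiff A C]: a sunflower, stated so as to be
    invariant under translations of the cube. *)
Definition star (T : finType) (F : {set {set T}}) (C : {set T}) (w : nat)
    (S : {set {set T}}) :=
  [/\ S \subset F, (forall A, A \in S -> #|symdiff A C| = w) &
      {in S &, forall A B, A != B -> [disjoint symdiff A C & symdiff B C]}].

Lemma star_sub (T : finType) (F F' : {set {set T}}) C w S :
  F \subset F' -> star F C w S -> star F' C w S.
Proof. by move=> sF [h1 h2 h3]; split=> //; apply: fintype.subset_trans sF. Qed.

(** Each point of [Z] lies in at most one petal. *)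
Lemma star_avoid (T : finType) (F : {set {set T}}) C w S (Z : {set T}) :
  star F C w S -> #|Z| < #|S| -> exists2 A, A \in S & [disjoint symdiff A C & Z].
Proof.
move=> [_ _ dS] ZS.
case: (pickP (fun A => (A \in S) && [disjoint symdiff A C & Z])) => [A /andP[]|no].
  by exists A.
pose f A : option T := [pick x in symdiff A C :&: Z].
have fP A : A \in S -> exists2 x, f A = Some x & (x \in symdiff A C) && (x \in Z).
  move=> AS; rewrite /f; case: pickP => [x|h].
    by rewrite inE => hx; exists x.
  move: (no A); rewrite AS /= => /negP[]; apply/pred0P => x /=.
  by have := h x; rewrite inE.
have : #|f @: S| <= #|Some @: Z|.
  apply/subset_leq_card/fintype.subsetP => _ /imsetP[A AS ->].
  by have [x -> /andP[_ xZ]] := fP A AS; apply: imset_f.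
rewrite (card_imset _ (@Some_inj _)) card_in_imset => [|A B AS BS].
  by rewrite leqNgt ZS.
have [x -> /andP[xA _]] := fP A AS; have [y -> /andP[yB _]] := fP B BS.
case=> xy; apply/eqP/negPn/negP => /(dS A B AS BS) /pred0P /(_ x) /=.
by rewrite xA xy yB.
Qed.

(** The bound on [#|S|] makes some petal disjoint from [symdiff X C], because
    [X] is within [K + w] of [C]; distances through that petal add up. *)
Lemma star_dist (D : {pred nat}) n (F : {set {set 'I_n}}) C w S K X :
    distance_family D F -> {in D, forall x, x <= K} -> star F C w S ->
    0 < w -> K + w < #|S| -> X \in F ->
  exists2 A, A \in S &
    (#|symdiff X A| == #|symdiff X C| + w) && (#|symdiff X A| \in D).
Proof.
move=> /distance_familyP FD DK st w0 cS XF.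
have [SF Sw _] := st; move/fintype.subsetP: SF => SF.
have [A0 A0S] : exists A0, A0 \in S by apply/card_gt0P; apply: leq_trans cS.
have XK : #|symdiff X A0| <= K.
  have [->|XA] := eqVneq X A0; last by apply/DK/FD => //; apply: SF.
  by have /eqP := card_symdiff_eq0 A0 A0; rewrite eqxx => /eqP/eqP ->.
have [|A AS dA] := @star_avoid _ _ _ _ _ (symdiff X C) st.
  apply: leq_ltn_trans cS; apply: leq_trans (card_symdiff_triangle A0 X C) _.
  by rewrite [symdiff C _]symdiffC (Sw _ A0S) leq_add2r.
have e : #|symdiff X A| = #|symdiff X C| + w.
  by rewrite symdiffC -(symdiff_shift A X C) card_symdiff_disjoint // (Sw _ AS) addnC.
exists A; rewrite // e eqxx -e; apply: FD => //; first exact: SF.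
by rewrite -card_symdiff_eq0 e -lt0n; lia.
Qed.

(** For every [X] the members [A] with [X \subset A] and [#|A :\: X| = w] meet a
    bounded set [Y X], the union of a maximal star with kernel [X]. Choose a
    random point of [Y X] for each [X], and keep [A] when it contains the points
    chosen for all its admissible [X]. Two kept sets at distance [2 * w] would
    have [X = A1 :&: A2] admissible for both and share a point outside [X]. *)
Lemma star_free_subfamily (T : finType) (F : {set {set T}}) (u w m : nat) :
    0 < w -> 0 < m -> (forall A, A \in F -> #|A| = u) ->
    (forall C S, star F C w S -> #|S| <= m) ->
  exists G : {set {set T}}, [/\ G \subset F, #|F| <= (m * w) ^ (2 ^ u) * #|G| &
    forall A B, A \in G -> B \in G -> #|symdiff A B| != 2 * w].
Proof.
move=> w0 m0 Fu noS.
pose P (X : {set T}) (S : {set {set T}}) :=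
  [&& S \subset F, [forall A in S, (X \subset A) && (#|symdiff A X| == w)] &
   [forall A in S, forall B in S, (A != B) ==> [disjoint symdiff A X & symdiff B X]]].
have PP X S : P X S -> star F X w S.
  case/and3P => h1 /forall_inP h2 /forall_inP h3; split => // [A AS|A B AS BS].
    by have /andP[_ /eqP] := h2 A AS.
  by move/forall_inP: (h3 A AS) => /(_ B BS) /implyP.
have P0 X : P X finset.set0.
  by apply/and3P; split; rewrite ?finset.sub0set //; apply/forall_inP => A; rewrite inE.
(* [M X] is a maximal star with kernel [X]. *)
pose M X := [arg max_(S > finset.set0 | P X S) #|S|].
have MP X : P X (M X) by rewrite /M; case: arg_maxnP.
have Mmax X S : P X S -> #|S| <= #|M X|.
  by move=> PS; rewrite /M; case: arg_maxnP => // S' _; apply.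
pose Y X := \bigcup_(A in M X) symdiff A X.
have cY X : #|Y X| <= m * w.
  apply: leq_trans (leq_card_bigcup _ _) _.
  have [_ h _] := PP _ _ (MP X); rewrite (eq_bigr (fun=> w)) //.
  by rewrite sum_nat_const leq_mul2r (noS X) ?orbT //; apply/PP/MP.
(* Otherwise [B] could be added to the star [M X]. *)
have YP (X B : {set T}) : B \in F -> X \subset B -> #|symdiff B X| = w ->
    exists2 y, y \in Y X & y \in symdiff B X.
  move=> BF XB cB.
  have [/pred0P h|] := boolP [disjoint symdiff B X & Y X]; last first.
    by case/pred0Pn => y /andP[y1 y2]; exists y.
  have BM : B \notin M X.
    apply/negP => BM; have /card_gt0P[y yB] : 0 < #|symdiff B X| by rewrite cB.
    have := h y; rewrite /= yB /= => /negP[]; apply/bigcupP; by exists B.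
  have : #|B |: M X| <= #|M X|.
    apply: Mmax; have /and3P[M1 /forall_inP M2 /forall_inP M3] := MP X.
    have dB A : A \in M X -> [disjoint symdiff B X & symdiff A X].
      move=> AM; apply/pred0P => y /=; apply/negP => /andP[yB yA].
      by have := h y; rewrite /= yB => /negP[]; apply/bigcupP; exists A.
    apply/and3P; split.
    - by rewrite finset.subUset finset.sub1set BF.
    - by apply/forall_inP => A; rewrite !inE => /orP[/eqP->|/M2//]; rewrite XB cB eqxx.
    apply/forall_inP => A; rewrite !inE => /orP[/eqP->|AM]; apply/forall_inP => A';
      rewrite !inE => /orP[/eqP->|AM']; apply/implyP => //.
    + by rewrite eqxx.
    + by move=> _; apply: dB.
    + by move=> _; rewrite disjoint_sym; apply: dB.
    by move/forall_inP: (M3 A AM) => /(_ _ AM') /implyP.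
  by rewrite cardsU1 BM ltnn.
pose S (A : {set T}) := [set X in powerset A | #|symdiff A X| == w].
(* Points of [Y X] are encoded by their ranks, to have one index type for all [X]. *)
pose B (A X : {set T}) : {set 'I_(m * w)} :=
  [set i : 'I_(m * w) | [exists y in symdiff A X, (y \in Y X) && (index y (enum (Y X)) == i)]].
have [||||g hg] := @exists_good_choice {set T} 'I_(m * w) {set T} (2 ^ u) 1 F S B.
- by rewrite card_ord muln_gt0 m0.
- by move=> A AF; rewrite -(Fu A AF) -card_powerset; apply/subset_leq_card/fintype.subsetP => X; rewrite inE => /andP[].
- move=> A X AF; rewrite !inE => /andP[XA /eqP cA]; apply/card_gt0P.
  have [y yY yA] := YP X A AF XA cA.
  have iy : index y (enum (Y X)) < m * w.
    by apply: leq_trans (cY X); rewrite cardE index_mem mem_enum.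
  by exists (Ordinal iy); rewrite inE; apply/exists_inP; exists y; rewrite // yY /=.
- by rewrite card_ord muln_gt0 m0.
move: hg; rewrite exp1n mul1n card_ord => hg.
exists [set i in F | [forall j in S i, g j \in B i j]]; split => //.
  by apply/fintype.subsetP => A; rewrite inE => /andP[].
move=> A1 A2; rewrite !inE => /andP[A1F /forall_inP h1] /andP[A2F /forall_inP h2].
apply/negP => /eqP c2.
have cI := card_symdiff A1 A2; rewrite (Fu _ A1F) (Fu _ A2F) c2 in cI.
pose X := A1 :&: A2.
have hX A : A \in F -> X \subset A -> X \in S A.
  move=> AF XA; rewrite !inE XA /=; have := card_symdiff A X.
  by rewrite (finset.setIidPr XA) (Fu _ AF) /X => cAX; apply/eqP; move: cI cAX; lia.
have := h1 X (hX _ A1F (finset.subsetIl _ _)).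
have := h2 X (hX _ A2F (finset.subsetIr _ _)).
rewrite !inE => /exists_inP[y yA2 /andP[yY /eqP iy]] /exists_inP[z zA1 /andP[zY /eqP iz]].
have yz : y = z.
  by rewrite -(nth_index y (_ : y \in enum (Y X))) ?mem_enum // iy -iz nth_index ?mem_enum.
move: zA1 yA2; rewrite -yz !in_symdiff !inE; case: (y \in A1); case: (y \in A2) => //.
Qed.

(** * Even distances: the recursion on the largest distance *)

Lemma dist_set_drop_max e s t x :
  0 < e -> 0 < t -> x \in dist_set (2 * e) s t -> x < 2 * (e * t) ->
  x \in dist_set (2 * e) s t.-1.
Proof.
move=> e0 t0 /dist_setP[i /andP[si it] ->] lt; apply/dist_setP; exists i => //.
rewrite si /=; have : i < t by rewrite -(ltn_pmul2r e0); lia.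
by lia.
Qed.

Lemma shrunk_distance_family e s t n (F : {set {set 'I_n}}) :
  0 < e -> 0 < t -> distance_family [in dist_set (2 * e) s t] F ->
  (forall A B, A \in F -> B \in F -> #|symdiff A B| < 2 * (e * t)) ->
  #|F| <= max_distance_family [in dist_set (2 * e) s t.-1] n.
Proof.
move=> e0 t0 /distance_familyP FD lt; apply: leq_max_distance_family => A B AF BF AB.
by apply: dist_set_drop_max => //; [exact: FD|exact: lt].
Qed.

Lemma distance_family_sub (D : {pred nat}) n (F F' : {set {set 'I_n}}) :
  F' \subset F -> distance_family D F -> distance_family D F'.
Proof.
move=> /fintype.subsetP sF /distance_familyP FD; apply/distance_familyP.
by move=> A B /sF AF /sF BF; apply: FD.
Qed.

Lemma distance_family_shift (D : {pred nat}) n (F : {set {set 'I_n}}) C :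
  distance_family D F -> distance_family D [set symdiff A C | A in F].
Proof.
move=> /distance_familyP FD; apply/distance_familyP => _ _ /imsetP[A AF ->] /imsetP[B BF ->] AB.
by rewrite symdiff_shift; apply: FD => //; apply: contraNneq AB => ->.
Qed.

Lemma card_shift n (F : {set {set 'I_n}}) C : #|[set symdiff A C | A in F]| = #|F|.
Proof. by apply/card_imset/(can_inj (symdiffK C)). Qed.

Lemma star_unshift n (F : {set {set 'I_n}}) A0 C w S :
  star [set symdiff A A0 | A in F] C w S ->
  star F (symdiff C A0) w [set symdiff A A0 | A in S].
Proof.
move=> [/fintype.subsetP sF Sw Sd].
have e A : symdiff (symdiff A A0) (symdiff C A0) = symdiff A C by rewrite symdiff_shift.
split=> [|_ /imsetP[A AS ->]|_ _ /imsetP[A AS ->] /imsetP[B BS ->] AB]; rewrite ?e; first last.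
- by apply: Sd => //; apply: contraNneq AB => ->.
- exact: Sw.
apply/fintype.subsetP => _ /imsetP[A /sF /imsetP[B BF ->] ->].
by rewrite symdiffK.
Qed.

(** A family of even distances lies in a ball, so after a translation it splits
    into boundedly many uniform layers, and [star_free_subfamily] applies to
    each of them. What it leaves has lost the largest distance. *)
Lemma star_free_bound e s t m :
  0 < e -> 0 < t -> 0 < m -> exists C, forall n (F : {set {set 'I_n}}),
    distance_family [in dist_set (2 * e) s t] F ->
    (forall Z S, star F Z (e * t) S -> #|S| <= m) ->
    #|F| <= C * max_distance_family [in dist_set (2 * e) s t.-1] n.
Proof.
move=> e0 t0 m0; set w := e * t; have w0 : 0 < w by rewrite muln_gt0 e0.
(* One term for each possible size [u] of a member after translation. *)
exists (\sum_(u < (2 * w).+1) (m * w) ^ (2 ^ u)) => n F FD noS.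
have [->|/finset.set0Pn[A0 A0F]] := eqVneq F finset.set0; first by rewrite cards0.
pose F' := [set symdiff A A0 | A in F].
have FD' : distance_family [in dist_set (2 * e) s t] F' by apply: distance_family_shift.
have F'size A : A \in F' -> #|A| < (2 * w).+1.
  case/imsetP => B BF ->; rewrite ltnS.
  have [->|BA] := eqVneq B A0.
    by have := card_symdiff_eq0 A0 A0; rewrite eqxx => /eqP ->.
  move/distance_familyP: FD => /(_ B A0 BF A0F BA) /dist_setP[i /andP[_ it] ->].
  by rewrite /w; nia.
rewrite -(card_shift F A0) -/F' big_distrl /=.
have -> : #|F'| = \sum_(u < (2 * w).+1) #|[set A in F' | #|A| == u]|.
  rewrite -sum1_card (partition_big (fun A : {set 'I_n} => inord #|A| : 'I_(2 * w).+1) predT) //=.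
  apply: eq_bigr => u _; rewrite -sum1_card; apply: eq_bigl => A; rewrite !inE.
  case AF: (A \in F') => //=; rewrite -val_eqE /= inordK //; exact: F'size.
apply: leq_sum => u _; set Fu := [set A in F' | _].
have sFu : Fu \subset F' by apply/fintype.subsetP => A; rewrite inE => /andP[].
have [|Z S St|G [GF cG nG]] := @star_free_subfamily _ Fu u w m w0 m0.
- by move=> A; rewrite inE => /andP[_ /eqP].
- rewrite -(card_shift S A0); apply: (noS (symdiff Z A0)).
  by apply: star_unshift; apply: star_sub St.
apply: leq_trans cG _; rewrite leq_mul2l; apply/orP; right.
have sG := fintype.subset_trans GF sFu.
apply: shrunk_distance_family => //; first exact: distance_family_sub FD'.
move=> A B AG BG; rewrite ltn_neqAle nG //=.
have [->|AB] := eqVneq A B.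
  by have := card_symdiff_eq0 B B; rewrite eqxx => /eqP ->.
move/fintype.subsetP: sG => sG.
move/distance_familyP: FD' => /(_ A B (sG _ AG) (sG _ BG) AB) /dist_setP[i /andP[_ it] ->].
by nia.
Qed.

(** The triangle inequality excludes the largest distance. *)
Lemma inner_ball_bound e s t n (F : {set {set 'I_n}}) Z :
  0 < e -> 0 < t -> distance_family [in dist_set (2 * e) s t] F ->
  (forall A, A \in F -> #|symdiff A Z| < e * t) ->
  #|F| <= max_distance_family [in dist_set (2 * e) s t.-1] n.
Proof.
move=> e0 t0 FD FZ; apply: shrunk_distance_family => // A B AF BF.
by have := card_symdiff_triangle Z A B; have := FZ _ AF; have := FZ _ BF; lia.
Qed.

(** A common point of the two differences shortens the distance by 2. *)
Lemma ball_through_point_bound e s t n (F : {set {set 'I_n}}) Z x :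
  0 < e -> 0 < t -> distance_family [in dist_set (2 * e) s t] F ->
  (forall A, A \in F -> #|symdiff A Z| <= e * t) ->
  (forall A, A \in F -> x \in symdiff A Z) ->
  #|F| <= max_distance_family [in dist_set (2 * e) s t.-1] n.
Proof.
move=> e0 t0 FD FZ Fx; apply: shrunk_distance_family => // A B AF BF.
have := card_symdiff (symdiff A Z) (symdiff B Z); rewrite symdiff_shift.
have : 0 < #|symdiff A Z :&: symdiff B Z|.
  by apply/card_gt0P; exists x; rewrite inE !Fx.
by have := FZ _ AF; have := FZ _ BF; lia.
Qed.

(** Count the pairs of a point [x] and a member [A] on the sphere with [x] in
    [symdiff A Z]; the members inside the sphere contribute the term [e * t]. *)
Lemma ball_bound e s t n (F : {set {set 'I_n}}) Z :
  0 < e -> 0 < t -> distance_family [in dist_set (2 * e) s t] F ->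
  (forall A, A \in F -> #|symdiff A Z| <= e * t) ->
  (e * t) * #|F| <= (n + e * t) * max_distance_family [in dist_set (2 * e) s t.-1] n.
Proof.
move=> e0 t0 FD FZ; set g := max_distance_family _ _.
pose In := [set A in F | #|symdiff A Z| < e * t].
pose Sh := [set A in F | #|symdiff A Z| == e * t].
have cF : #|F| <= #|In| + #|Sh|.
  apply: leq_trans (leq_card_setU _ _); apply/subset_leq_card/fintype.subsetP => A AF.
  by rewrite !inE AF /= orbC -leq_eqVlt FZ.
have cIn : #|In| <= g.
  apply: (@inner_ball_bound _ _ _ _ _ Z) => //; last by move=> A; rewrite inE => /andP[].
  by apply: distance_family_sub FD; apply/fintype.subsetP => A; rewrite inE => /andP[].
have cSh : (e * t) * #|Sh| <= n * g.
  rewrite mulnC -sum_nat_const.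
  have -> : \sum_(A in Sh) e * t = \sum_(A in Sh) \sum_(x in symdiff A Z) 1.
    by apply: eq_bigr => A; rewrite inE sum1_card => /andP[_ /eqP].
  rewrite (exchange_big_dep predT) //= -[X in X * _]card_ord -sum_nat_const.
  apply: leq_sum => x _.
  have -> : \sum_(A in Sh | x \in symdiff A Z) 1 = #|[set A in Sh | x \in symdiff A Z]|.
    by rewrite -sum1_card; apply: eq_bigl => A; rewrite !inE.
  apply: (@ball_through_point_bound _ _ _ _ _ Z x) => //.
  - by apply: distance_family_sub FD; apply/fintype.subsetP => A; rewrite !inE; case/andP=> /andP[->].
  - by move=> A; rewrite !inE => /andP[/andP[_ /eqP->] _].
  - by move=> A; rewrite !inE => /andP[].
apply: leq_trans (leq_mul (leqnn (e * t)) cF) _.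
by rewrite mulnDr mulnDl addnC leq_add // leq_mul.
Qed.

Lemma max_distance_family_witness (D : {pred nat}) n :
  exists2 F : {set {set 'I_n}}, distance_family D F & #|F| = max_distance_family D n.
Proof.
have [|F FD eF] := @eq_bigmax_cond _ [pred F | @distance_family D n F] (fun F => #|F|).
  apply/card_gt0P; exists finset.set0; rewrite inE /=; apply/distance_familyP => A B.
  by rewrite inE.
by exists F; rewrite // -eF.
Qed.

(** A star forces the whole family into the ball whose radius is half of the
    largest distance. *)
Lemma even_star_ball e s t n (F : {set {set 'I_n}}) Z S :
  0 < e -> 0 < t -> distance_family [in dist_set (2 * e) s t] F ->
  star F Z (e * t) S -> 3 * (e * t) < #|S| ->
  forall A, A \in F -> #|symdiff A Z| <= e * t.
Proof.
move=> e0 t0 FD St cS A AF; have w0 : 0 < e * t by rewrite muln_gt0 e0.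
have le2 : {in [in dist_set (2 * e) s t], forall x, x <= 2 * (e * t)}.
  by move=> x /dist_setP[i /andP[_ it] ->]; nia.
have [|B BS /andP[/eqP eB BD]] := star_dist FD le2 St w0 _ AF; first by lia.
by have := le2 _ BD; rewrite eB; lia.
Qed.

(** With a star [ball_bound] applies; without one [star_free_bound] gives a bound
    with no factor [n], which the constant [C] absorbs. *)
Lemma even_recursion e s t :
  0 < e -> 0 < t -> exists C, forall n,
    (e * t) * max_distance_family [in dist_set (2 * e) s t] n <=
    (n + C) * max_distance_family [in dist_set (2 * e) s t.-1] n.
Proof.
move=> e0 t0; set w := e * t; have w0 : 0 < w by rewrite muln_gt0 e0.
have [|C hC] := @star_free_bound e s t (3 * w) e0 t0; first by rewrite muln_gt0.
exists (w * C + w) => n; set g := max_distance_family [in dist_set _ _ t.-1] n.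
have [F FD <-] := max_distance_family_witness [in dist_set (2 * e) s t] n.
have [[Z [S [St cS]]]|no] := pselect (exists Z S, star F Z w S /\ 3 * w < #|S|).
  apply: leq_trans (@ball_bound e s t n F Z e0 t0 FD _) _.
    exact: (even_star_ball e0 t0 FD St cS).
  by rewrite leq_mul2r; apply/orP; right; rewrite -/w; lia.
apply: leq_trans (_ : w * (C * g) <= _); last by nia.
rewrite leq_mul2l hC ?orbT // => Z S St; rewrite leqNgt; apply/negP => cS.
by apply: no; exists Z, S; split.
Qed.

Lemma max_distance_family_empty d s t n :
  t < s -> max_distance_family [in dist_set d s t] n <= 1.
Proof.
move=> ts; apply: max_distance_family_leq => F /distance_familyP FD.
rewrite leqNgt; apply/negP => /card_gt1P[A [B [AF BF AB]]].
by have /dist_setP[i hi _] := FD A B AF BF AB; lia.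
Qed.

Lemma even_distance_bound e s t :
  0 < e -> 0 < s -> s <= t.+1 -> exists C, forall n,
    (\prod_(s <= i < t.+1) (e * i)) * max_distance_family [in dist_set (2 * e) s t] n
      <= (n + C) ^ (t.+1 - s).
Proof.
move=> e0 s0; elim: t => [|t IH] st.
  have -> : s = 1 by lia.
  by exists 0 => n; rewrite big_geq // mul1n max_distance_family_empty.
have [->|st'] := eqVneq s t.+2.
  by exists 0 => n; rewrite big_geq // mul1n subnn max_distance_family_empty.
have {}st : s <= t.+1 by lia.
have [C hC] := IH st; have [C' hC'] := @even_recursion e s t.+1 e0 isT.
exists (C + C') => n; rewrite big_nat_recr //= subSn // expnS.
have h1 := hC n; have h2 := hC' n; rewrite /= in h2.
rewrite -mulnA; apply: leq_trans (leq_mul (leqnn _) h2) _.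
rewrite mulnCA; apply: leq_mul; first by rewrite leq_add2l leq_addl.
apply: leq_trans h1 _; case: (posnP (t.+1 - s)) => [->|h]; rewrite ?expn0 // leq_exp2r //.
by rewrite leq_add2l leq_addr.
Qed.

(** * Odd multiples: the two parity classes *)

Lemma dist_set_even_part d s t x :
  odd d -> x \in dist_set d s t -> ~~ odd x -> x \in dist_set (2 * d) (uphalf s) t./2.
Proof.
move=> dodd /dist_setP[i /andP[si it] ->]; rewrite oddM dodd andbT => ei.
have ei2 : i = i./2.*2 by have := odd_double_half i; rewrite (negbTE ei).
apply/dist_setP; exists i./2; last by lia.
by rewrite half_leq // andbT leq_uphalf_double -ei2.
Qed.

Definition parity_class n (F : {set {set 'I_n}}) (b : bool) :=
  [set A in F | odd #|A| == b].

Lemma parity_class_sub n (F : {set {set 'I_n}}) b : parity_class F b \subset F.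
Proof. by apply/fintype.subsetP => A; rewrite inE => /andP[]. Qed.

Lemma card_parity_class n (F : {set {set 'I_n}}) b :
  #|F| = #|parity_class F b| + #|parity_class F (~~ b)|.
Proof.
rewrite -(cardsID (parity_class F b) F); congr (_ + _); apply: eq_card => A; rewrite !inE;
by case: (A \in F); case: (odd _); case: b.
Qed.

Lemma parity_class_family d s t n (F : {set {set 'I_n}}) b :
  odd d -> distance_family [in dist_set d s t] F ->
  distance_family [in dist_set (2 * d) (uphalf s) t./2] (parity_class F b).
Proof.
move=> dodd /distance_familyP FD; apply/distance_familyP => A B.
rewrite !inE => /andP[AF /eqP oA] /andP[BF /eqP oB] AB.
apply: dist_set_even_part => //; first exact: FD.
by rewrite odd_card_symdiff oA oB addbb.
Qed.

Lemma odd_distance_bound2 d s t n : odd d ->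
  max_distance_family [in dist_set d s t] n <=
  2 * max_distance_family [in dist_set (2 * d) (uphalf s) t./2] n.
Proof.
move=> dodd; apply: max_distance_family_leq => F FD.
rewrite (card_parity_class F true) mul2n -addnn leq_add //;
  exact/leq_max_distance_family/distance_familyP/parity_class_family.
Qed.

(** The members inside the sphere fall under [inner_ball_bound]; those whose
    difference from the centre meets [E] pass through one of [#|E|] points. This
    frees a bounded set of points before two classes are merged. *)
Lemma core_bound e s t n (F : {set {set 'I_n}}) Z (E : {set 'I_n}) :
  0 < e -> 0 < t -> distance_family [in dist_set (2 * e) s t] F ->
  (forall A, A \in F -> #|symdiff A Z| <= e * t) ->
  #|F| <= #|[set A in F | (#|symdiff A Z| == e * t) && [disjoint symdiff A Z & E]]|
          + #|E|.+1 * max_distance_family [in dist_set (2 * e) s t.-1] n.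
Proof.
move=> e0 t0 FD FZ; set g := max_distance_family _ _; set G := [set A in F | _ && _].
pose In := [set A in F | #|symdiff A Z| < e * t].
pose Th (x : 'I_n) := [set A in F | x \in symdiff A Z].
have cF : #|F| <= #|G| + (#|In| + #|\bigcup_(x in E) Th x|).
  apply: leq_trans (leq_add (leqnn _) (leq_card_setU _ _)).
  apply: leq_trans (leq_card_setU _ _); apply/subset_leq_card/fintype.subsetP => A AF.
  rewrite !inE AF /=; have := FZ A AF; rewrite leq_eqVlt => /orP[/eqP eA|->]; last by rewrite orbT.
  rewrite eA eqxx ltnn /=; have [//|/pred0Pn[x /andP[xA xE]]] := boolP [disjoint _ & _].
  by apply/bigcupP; exists x => //; rewrite inE AF.
have cIn : #|In| <= g.
  apply: (@inner_ball_bound _ _ _ _ _ Z) => //; last by move=> A; rewrite inE => /andP[].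
  by apply: distance_family_sub FD; apply/fintype.subsetP => A; rewrite inE => /andP[].
have cTh : #|\bigcup_(x in E) Th x| <= #|E| * g.
  apply: leq_trans (leq_card_bigcup _ _) _; rewrite -sum_nat_const; apply: leq_sum => x _.
  apply: (@ball_through_point_bound _ _ _ _ _ Z x) => //.
  - by apply: distance_family_sub FD; apply/fintype.subsetP => A; rewrite inE => /andP[].
  - by move=> A; rewrite inE => /andP[/FZ].
  - by move=> A; rewrite inE => /andP[].
by rewrite mulSn; lia.
Qed.

(** For even [t] the star has petals of size [t * d / 2]. A member of the other
    class has an odd distance to the star, hence at most [(t - 1) * d], and lies
    strictly inside the ball. *)
Lemma opposite_class_bound d s t n (F : {set {set 'I_n}}) b Z S :
  odd d -> 0 < t -> ~~ odd t -> distance_family [in dist_set d s t] F ->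
  star (parity_class F b) Z (d * t./2) S -> 2 * (t * d) < #|S| ->
  #|parity_class F (~~ b)| <=
    max_distance_family [in dist_set (2 * d) (uphalf s) (t./2).-1] n.
Proof.
move=> dodd t0 tev FD St cS; have d0 : 0 < d by case: d dodd {FD St cS}.
have et : t = 2 * t./2 by rewrite mul2n; have := odd_double_half t; rewrite (negbTE tev).
apply: (@inner_ball_bound _ _ _ _ _ Z) => //; first by lia.
  exact: parity_class_family.
move=> A; rewrite inE => /andP[AF /eqP oA].
have leK : {in [in dist_set d s t], forall x, x <= t * d}.
  by move=> x /dist_setP[i /andP[_ it] ->]; rewrite leq_mul2r it orbT.
have St' := star_sub (parity_class_sub F b) St.
have w0 : 0 < d * t./2 by rewrite muln_gt0 d0; lia.
have [|B BS /andP[/eqP eB BD]] := star_dist FD leK St' w0 _ AF; first by nia.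
have : B \in parity_class F b by case: St => /fintype.subsetP sS _ _; apply: sS.
rewrite inE => /andP[_ /eqP oB].
have oAB : odd #|symdiff A B| by rewrite odd_card_symdiff oA oB; case: b {St St' oA oB}.
have /dist_setP[i /andP[_ it] ei] := BD.
have iodd : odd i by move: oAB; rewrite ei oddM => /andP[].
have i_lt : i < t by rewrite ltn_neqAle it andbT; apply: contraNneq tev => <-.
have : i * d < t * d by rewrite ltn_pmul2r.
by rewrite -ei eB; clear - et d0; nia.
Qed.

(** For [s] even and [t] odd the distance between the centres is forced to be
    [d]: added to twice a petal it must be an odd multiple of [d] that is at
    most [t * d]. Recentring both classes at the empty set lowers each cross
    distance by [d] as soon as the sets avoid [E], so an odd multiple of [d] in
    the range becomes an even one, still at least [s * d] because [s] is even. *)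
Lemma glued_classes_bound d s t n (F : {set {set 'I_n}}) Z S :
  odd d -> 0 < s -> s <= t -> ~~ odd s -> odd t -> distance_family [in dist_set d s t] F ->
  (forall b, star (parity_class F b) (Z b) (d * t./2) (S b)) ->
  (forall b, 2 * (t * d) < #|S b|) ->
  #|F| <= max_distance_family [in dist_set (2 * d) (uphalf s) t./2] n
     + 2 * d.+1 * max_distance_family [in dist_set (2 * d) (uphalf s) (t./2).-1] n.
Proof.
move=> dodd s0 st sev todd FD St cS; have d0 : 0 < d by case: d dodd {FD St cS}.
have et : t = (2 * t./2).+1 by rewrite mul2n; have := odd_double_half t; rewrite todd.
have es : s = 2 * uphalf s.
  by rewrite uphalf_half (negbTE sev) mul2n; have := odd_double_half s; rewrite (negbTE sev).
set w := d * t./2 in St *; have t2 : 0 < t./2 by lia.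
have w0 : 0 < w by rewrite muln_gt0 d0.
have tw : t * d = 2 * w + d by rewrite /w {1}et; nia.
pose E := symdiff (Z false) (Z true).
have leK : {in [in dist_set d s t], forall x, x <= t * d}.
  by move=> x /dist_setP[i /andP[_ it] ->]; rewrite leq_mul2r it orbT.
have St' b := star_sub (parity_class_sub F b) (St b).
have inS b A : A \in S b -> (A \in F) /\ odd #|A| = b.
  by move=> AS; have [/fintype.subsetP sS _ _] := St b; have := sS _ AS; rewrite inE => /andP[? /eqP].
have cross A B : A \in F -> B \in F -> odd #|A| = ~~ odd #|B| ->
    exists i, [/\ odd i, s < i <= t & #|symdiff A B| = i * d].
  move=> AF BF oAB.
  have nAB : A != B by apply/eqP => e; move: oAB; rewrite e; case: odd.
  have : odd #|symdiff A B| by rewrite odd_card_symdiff oAB; case: odd.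
  have /dist_setP[i /andP[si it] ->] : #|symdiff A B| \in dist_set d s t by move/distance_familyP: FD; apply.
  rewrite oddM => /andP[oi _]; exists i; split=> //; rewrite it andbT ltn_neqAle si andbT.
  by apply: contraNneq sev => ->.
have ball b A : A \in parity_class F b -> #|symdiff A (Z b)| <= w.
  move=> AF; apply: (even_star_ball d0 t2 (parity_class_family b dodd FD) (St b)) => //.
  by have := cS b; rewrite -/w; lia.
(* Compare a member of one star with a member of the other, petals disjoint. *)
have cE : #|E| = d.
  have [A0 A0S] : exists A, A \in S false by apply/card_gt0P; apply: leq_ltn_trans (cS false).
  have [A1 A1S] : exists A, A \in S true by apply/card_gt0P; apply: leq_ltn_trans (cS true).
  have leE : #|E| <= 2 * (t * d).
    have [A0F oA0] := inS _ _ A0S; have [A1F oA1] := inS _ _ A1S.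
    have [|i [_ _ ei]] := cross A0 A1 A0F A1F; first by rewrite oA0 oA1.
    have := leK #|symdiff A0 A1|; have /distance_familyP FD' := FD.
    have nA : A0 != A1 by apply/eqP => e; move: oA0; rewrite e oA1.
    move=> /(_ (FD' _ _ A0F A1F nA)) leA.
    have h1 := card_symdiff_triangle A0 (Z false) (Z true).
    have h2 := card_symdiff_triangle A1 (Z true) A0.
    have [_ Sw0 _] := St false; have [_ Sw1 _] := St true.
    have := Sw0 _ A0S; have := Sw1 _ A1S.
    move: h1 h2 leA; rewrite -/E (symdiffC (Z false) A0) (symdiffC (Z true) A0) (symdiffC (Z true) A1).
    by clear - tw; lia.
  have [|P PS dP] := star_avoid (St false) (_ : #|E| < _); first exact: leq_ltn_trans leE (cS false).
  have [PF oP] := inS _ _ PS.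
  have [|Q QS /andP[/eqP eQ _]] := star_dist FD leK (St' true) w0 _ PF.
    by have := cS true; clear - tw; lia.
  have [QF oQ] := inS _ _ QS.
  have [|i [oi /andP[_ it] ei]] := cross P Q PF QF; first by rewrite oP oQ.
  have eP : #|symdiff P (Z true)| = w + #|E|.
    have -> : symdiff P (Z true) = symdiff (symdiff P (Z false)) E.
      by rewrite -symdiffA; congr symdiff; rewrite symdiffA; apply/finset.setP => x; rewrite !in_symdiff addbb.
    by rewrite card_symdiff_disjoint //; have [_ -> ] := St false.
  have e1 : i * d = 2 * w + #|E| by rewrite -ei eQ eP; clear; lia.
  have : 2 * t./2 <= i by rewrite -(leq_pmul2r d0) e1 /w; clear; lia.
  rewrite leq_eqVlt => /orP[/eqP ie|lti]; first by move: oi; rewrite -ie oddM.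
  have it' : i = t by clear - it lti et; lia.
  by move: e1; rewrite it' tw; clear; lia.
pose G b := [set A in parity_class F b | (#|symdiff A (Z b)| == w) && [disjoint symdiff A (Z b) & E]].
set g' := max_distance_family [in dist_set _ _ (t./2).-1] n.
have cG b : #|parity_class F b| <= #|G b| + d.+1 * g'.
  rewrite -cE; apply: core_bound => //; first exact: parity_class_family.
  exact: ball.
pose H b := [set symdiff A (Z b) | A in G b].
have HG b : #|H b| = #|G b| by apply: card_shift.
have GP b A : A \in G b -> [/\ A \in F, odd #|A| = b & [disjoint symdiff A (Z b) & E]].
  by rewrite !inE => /andP[/andP[? /eqP ?] /andP[_ ?]].
have crossH A B : A \in G false -> B \in G true ->
   exists2 i, uphalf s <= i <= t./2 & #|symdiff (symdiff A (Z false)) (symdiff B (Z true))| = i * (2 * d).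
  move=> /GP[AF oA dA] /GP[BF oB dB].
  have [|i [oi /andP[si it] ei]] := cross A B AF BF; first by rewrite oA oB.
  have dAB : [disjoint symdiff (symdiff A (Z false)) (symdiff B (Z true)) & E].
    apply/pred0P => x /=; rewrite in_symdiff.
    move/pred0P: dA => /(_ x) /=; move/pred0P: dB => /(_ x) /=.
    by case: (x \in E); rewrite ?andbF // !andbT => -> ->.
  have := card_symdiff_disjoint dAB.
  have -> : symdiff (symdiff (symdiff A (Z false)) (symdiff B (Z true))) E = symdiff A B.
    apply/finset.setP => x; rewrite !in_symdiff.
    by case: (x \in A); case: (x \in B); case: (x \in Z false); case: (x \in Z true).
  rewrite ei cE => eH; exists i./2.
    by rewrite half_leq // andbT leq_uphalf_double; have := odd_double_half i; rewrite oi; clear - si es; lia.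
  have := odd_double_half i; rewrite oi; move: eH; clear; nia.
(* Equal recentred sets would be at distance 0, while cross distances are positive. *)
have dH : [disjoint H false & H true].
  apply/pred0P => X /=; apply/negP => /andP[/imsetP[A AG ->] /imsetP[B BG eAB]].
  have [i hi] := crossH A B AG BG; rewrite eAB.
  have /eqP := card_symdiff_eq0 (symdiff B (Z true)) (symdiff B (Z true)); rewrite eqxx => /eqP/eqP ->.
  by nia.
have cH : #|H false :|: H true| <= max_distance_family [in dist_set (2 * d) (uphalf s) t./2] n.
  have same b X Y : X \in H b -> Y \in H b -> X != Y -> #|symdiff X Y| \in dist_set (2 * d) (uphalf s) t./2.
    move=> /imsetP[A AG ->] /imsetP[B BG ->] nAB; rewrite symdiff_shift.
    have /distance_familyP := parity_class_family b dodd FD; apply.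
    - by move: AG; rewrite inE => /andP[].
    - by move: BG; rewrite inE => /andP[].
    - by apply: contraNneq nAB => ->.
  have diff X Y : X \in H false -> Y \in H true -> #|symdiff X Y| \in dist_set (2 * d) (uphalf s) t./2.
    by move=> /imsetP[A AG ->] /imsetP[B BG ->]; apply/dist_setP; apply: crossH.
  apply: leq_max_distance_family => X Y; rewrite !finset.in_setU => /orP[X0|X1] /orP[Y0|Y1] nXY.
  - exact: (same false X Y X0 Y0 nXY).
  - exact: (diff X Y X0 Y1).
  - by rewrite symdiffC; exact: (diff Y X Y0 X1).
  - exact: (same true X Y X1 Y1 nXY).
have := cG false; have := cG true; move: cH.
move: dH; rewrite -leq_card_setU => /eqP ->; rewrite !HG (card_parity_class F false) /=.
by nia.
Qed.

(** The second class costs only a lower-order term, whichever of the two classes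
    has a star. *)
Lemma odd_distance_bound1 d s t :
  odd d -> 0 < s -> s <= t -> ~~ odd (s * t) -> exists C, forall n,
  max_distance_family [in dist_set d s t] n <=
  max_distance_family [in dist_set (2 * d) (uphalf s) t./2] n
  + C * max_distance_family [in dist_set (2 * d) (uphalf s) (t./2).-1] n.
Proof.
move=> dodd s0 st steven; have d0 : 0 < d by case: d dodd.
have t2 : 0 < t./2 by case: t st steven => [|[|t]] //; case: s s0 => [|[]].
have [|C hC] := @star_free_bound d (uphalf s) t./2 (2 * (t * d)) d0 t2; first by nia.
exists (C + 2 * d.+1 + 1) => n; set g := max_distance_family [in dist_set _ _ t./2] n.
set g' := max_distance_family [in dist_set _ _ t./2.-1] n.
apply: max_distance_family_leq => F FD.
have cl b := parity_class_family b dodd FD.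
have leg b : #|parity_class F b| <= g by apply/leq_max_distance_family/distance_familyP/cl.
pose has_star b := exists Z S, star (parity_class F b) Z (d * t./2) S /\ 2 * (t * d) < #|S|.
have nostar b : ~ has_star b -> #|F| <= g + C * g'.
  move=> no; rewrite (card_parity_class F b) addnC leq_add //; apply: (hC _ _ (cl b)) => Z S St.
  by rewrite leqNgt; apply/negP => cS; apply: no; exists Z, S.
suff [c cC cF] : exists2 c, c <= C + 2 * d.+1 + 1 & #|F| <= g + c * g'.
  by apply: leq_trans cF _; rewrite leq_add2l leq_mul2r cC orbT.
have [[Z0 [S0 [St0 cS0]]]|/nostar h] := pselect (has_star false); last by exists C; rewrite // -addnA leq_addr.
have [[Z1 [S1 [St1 cS1]]]|/nostar h] := pselect (has_star true); last by exists C; rewrite // -addnA leq_addr.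
have [tev|todd] := boolP (~~ odd t).
  exists 1; first by rewrite leq_addl.
  rewrite (card_parity_class F false) mul1n; apply: leq_add; first exact: leg.
  exact: (opposite_class_bound dodd (leq_trans s0 st) tev FD St0 cS0).
rewrite negbK in todd; have sev : ~~ odd s by move: steven; rewrite oddM todd andbT.
exists (2 * d.+1); first by rewrite -addnA addnCA leq_addr.
apply: (@glued_classes_bound d s t n F (fun b => if b then Z1 else Z0) (fun b => if b then S1 else S0)) => //.
  by case.
by case.
Qed.

(** * Packings and their shadows *)

Definition packing (V : finType) (k r : nat) (P : {set {set V}}) : bool :=
  [forall A in P, #|A| == k] &&
  [forall A in P, forall B in P, (A != B) ==> (#|A :&: B| < r)].

Lemma packingP (V : finType) k r (P : {set {set V}}) :
  reflect ((forall A, A \in P -> #|A| = k) /\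
           (forall A B, A \in P -> B \in P -> A != B -> #|A :&: B| < r))
          (packing k r P).
Proof.
apply: (iffP andP) => -[h1 h2]; split.
- by move=> A AP; apply/eqP/(forall_inP h1).
- by move=> A B AP BP; move/forall_inP: (forall_inP h2 A AP) => /(_ B BP)/implyP.
- by apply/forall_inP => A /h1 ->.
- by apply/forall_inP => A AP; apply/forall_inP => B BP; apply/implyP; apply: h2.
Qed.

(** As [r <= k], blocks that meet in fewer than [r] points are distinct, so
    blocks with different indices are counted separately. *)
Lemma indexed_packing (I V : finType) k r (D : {set I}) (f : I -> {set V}) :
  r <= k -> (forall i, i \in D -> #|f i| = k) ->
  (forall i j, i \in D -> j \in D -> i != j -> #|f i :&: f j| < r) ->
  packing k r (f @: D) /\ #|f @: D| = #|D|.
Proof.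
move=> rk fk fr; split.
  apply/packingP; split => [_ /imsetP[i iD ->]|_ _ /imsetP[i iD ->] /imsetP[j jD ->] fij].
    exact: fk.
  by apply: fr => //; apply: contraNneq fij => ->.
apply: card_in_imset => i j iD jD fij; apply/eqP/negPn/negP => nij.
by have := fr i j iD jD nij; rewrite fij finset.setIid fk // ltnNge rk.
Qed.

Definition shadow (V : finType) r (P : {set {set V}}) : {set {set V}} :=
  [set T : {set V} | (#|T| == r) && [exists A in P, T \subset A]].

(** Two blocks of a packing share no [r]-set. *)
Lemma card_shadow (V : finType) k r (P : {set {set V}}) :
  packing k r P -> #|shadow r P| = #|P| * 'C(k, r).
Proof.
case/packingP => Pk Pr.
rewrite -sum_nat_const.
have -> : \sum_(A in P) 'C(k, r) = \sum_(A in P) \sum_(T : {set V} | (T \subset A) && (#|T| == r)) 1.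
  apply: eq_bigr => A AP; rewrite -(Pk A AP) -cards_draws -sum1_card.
  by apply: eq_bigl => T; rewrite inE.
rewrite (exchange_big_dep (fun T => T \in shadow r P)) /=; last first.
  by move=> A T AP /andP[TA cT]; rewrite inE cT; apply/exists_inP; exists A.
rewrite -sum1_card; apply: eq_bigr => T; rewrite inE => /andP[cT /exists_inP[A AP TA]].
rewrite (big_pred1 A) // => B /=; apply/andP/eqP => [[BP /andP[TB _]]|->]; last by rewrite TA.
apply/eqP/negPn/negP => nBA; have := Pr _ _ BP AP nBA.
by rewrite ltnNge -(eqP cT) => /negP[]; apply/subset_leq_card; rewrite finset.subsetI TB.
Qed.

Lemma perm_imset_trans (V : finType) (A B : {set V}) :
  #|A| = #|B| -> exists s : {perm V}, s @: A = B.
Proof.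
(* List [A] and then its complement, do the same for [B], and match the two lists. *)
move=> eAB; pose l (C : {set V}) := enum C ++ enum (~: C).
have lP C x : x \in l C by rewrite mem_cat !mem_enum inE orbN.
have lU C : uniq (l C).
  rewrite cat_uniq !enum_uniq andbT /=; apply/hasPn => x.
  by rewrite !mem_enum inE.
have ls C : size (l C) = #|V| by rewrite size_cat -!cardE cardsC.
pose f x := nth x (l B) (index x (l A)).
have il C x : index x (l C) < #|V| by rewrite -(ls C) index_mem.
have f_inj : injective f.
  move=> x y; rewrite /f (set_nth_default y) ?ls ?il //.
  move/eqP; rewrite nth_uniq ?ls ?il // => /eqP /(congr1 (nth x (l A))).
  by rewrite !nth_index // (set_nth_default y) ?ls ?il ?nth_index.
exists (perm f_inj); apply/eqP; rewrite eqEcard card_imset ?eAB ?leqnn ?andbT; last exact: perm_inj.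
apply/fintype.subsetP => _ /imsetP[x xA ->]; rewrite permE /f.
have ix : index x (l A) < #|B|.
  by rewrite index_cat mem_enum xA -eAB cardE index_mem mem_enum.
by rewrite nth_cat -cardE ix -mem_enum mem_nth // -cardE.
Qed.

Lemma card_perm_type (V : finType) : #|{perm V}| = (#|V|)`!.
Proof.
rewrite -[#|V|]cardsT -card_perm; apply: eq_card => s.
by rewrite inE; apply/esym/fintype.subsetP => x; rewrite inE.
Qed.

(** The symmetric group is transitive on [r]-sets, so under a random permutation
    each of them falls in [Sh] with the same probability. *)
Lemma card_perm_shadow (V : finType) r (Sh : {set {set V}}) (T : {set V}) :
  (forall U, U \in Sh -> #|U| = r) -> #|T| = r ->
  #|[set s : {perm V} | s @: T \in Sh]| * 'C(#|V|, r) = (#|V|)`! * #|Sh|.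
Proof.
move=> Shr Tr.
pose N (U : {set V}) := #|[set s : {perm V} | s @: U \in Sh]|.
have Ncst (U : {set V}) : #|U| = r -> N U = N T.
  move=> Ur; have [t <-] : exists t : {perm V}, t @: T = U by apply: perm_imset_trans; rewrite Tr.
  rewrite /N -(card_imset _ (mulgI t)) /=; apply: eq_card => s; apply/imsetP/idP => [[s' + ->]|].
    by rewrite !inE -imset_comp => h; rewrite (eq_imset _ (permM _ _)).
  rewrite inE => sT; exists (t^-1 * s)%g; last by rewrite mulgA mulgV mul1g.
  rewrite inE -imset_comp (eq_imset (g := s)) // => x /=.
  by rewrite permM permK.
rewrite -[LHS]/(N T * _) mulnC -(card_draws V r) -sum_nat_const.
have -> : \sum_(U in [set A : {set V} | #|A| == r]) N T
   = \sum_(U in [set A : {set V} | #|A| == r]) \sum_(s : {perm V} | s @: U \in Sh) 1.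
  apply: eq_bigr => U; rewrite inE => /eqP /Ncst <-; rewrite /N -sum1_card.
  by apply: eq_bigl => s; rewrite inE.
rewrite -card_perm_type.
rewrite (exchange_big_dep predT) //= -sum_nat_const.
apply: eq_bigr => s _.
rewrite -(card_imset (mem Sh) (imset_inj (@perm_inj _ (s^-1)%g))) -sum1_card.
apply: eq_bigl => U; rewrite inE; apply/andP/imsetP => [[_ sU]|[U' U'S ->]].
  exists (s @: U) => //; rewrite -imset_comp -[LHS]imset_id; apply: eq_imset => x /=; by rewrite permK.
rewrite card_imset ?Shr ?eqxx //=; last exact: perm_inj.
split=> //; rewrite -imset_comp (eq_imset (g := id)) ?imset_id // => x /=; by rewrite permKV.
Qed.

(** * Packings on graphs of code words *)

Definition graph_over (M Q : finType) (c : M -> Q) (K : {set M}) : {set M * Q} :=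
  [set (i, c i) | i in K].

Lemma card_graph_over (M Q : finType) (c : M -> Q) (K : {set M}) :
  #|graph_over c K| = #|K|.
Proof. by apply: card_imset => i j []. Qed.

Definition agreement (M Q : finType) (c c' : M -> Q) : {set M} := [set i | c i == c' i].

Lemma graph_overI (M Q : finType) (c c' : M -> Q) (K K' : {set M}) :
  graph_over c K :&: graph_over c' K' = graph_over c (K :&: K' :&: agreement c c').
Proof.
apply/finset.setP => -[i a]; rewrite !inE; apply/andP/imsetP.
  move=> [/imsetP[j jK [-> ->]] /imsetP[j' jK' [e1 e2]]].
  by exists j => //; rewrite !inE jK; move: e2; rewrite e1 jK' => ->; rewrite eqxx.
move=> [j]; rewrite !inE => /andP[/andP[jK jK'] /eqP e] [-> ->]; split; apply/imsetP.
  by exists j.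
by exists j; rewrite // e.
Qed.

Lemma card_graph_overI (M Q : finType) (c c' : M -> Q) (K K' : {set M}) :
  #|graph_over c K :&: graph_over c' K'| = #|K :&: K' :&: agreement c c'|.
Proof. by rewrite graph_overI card_graph_over. Qed.

Lemma agreement_refl (M Q : finType) (c : M -> Q) K : K :&: agreement c c = K.
Proof. by apply/finset.setP => i; rewrite !inE eqxx andbT. Qed.

(** Blocks on different graphs meet in at most the agreement of the two words. *)
Lemma lifted_packing (M Q X : finType) k r (u : X -> M -> Q) (P : {set {set M}}) :
  r <= k -> packing k r P ->
  (forall x y, x != y -> #|agreement (u x) (u y)| < r) ->
  let G := [set graph_over (u z.1) z.2 | z in [set z : X * {set M} | z.2 \in P]] in
  packing k r G /\ #|G| = #|X| * #|P|.
Proof.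
move=> rk /packingP[Pk Pr] ur /=.
have [||pG cG] := @indexed_packing _ _ k r [set z : X * {set M} | z.2 \in P]
   (fun z => graph_over (u z.1) z.2) rk.
- by move=> [x A]; rewrite inE /= card_graph_over; apply: Pk.
- move=> [x A] [y B]; rewrite !inE /= => AP BP; rewrite card_graph_overI.
  have [->|nxy _] := eqVneq x y.
    rewrite agreement_refl xpair_eqE eqxx /=; exact: Pr.
  by apply: leq_ltn_trans (ur x y nxy); apply/subset_leq_card/finset.subsetIr.
split=> //; rewrite cG -cardsT -cardsX; apply: eq_card => -[x A].
by rewrite !inE.
Qed.

(** The gain counts the blocks put on the graphs of [v]. A block [A] on the graph
    of [v y] is compatible with the permuted copies on the graphs of [u] unless
    some [r]-subset of [A] on which [v y] agrees with some [u x] is covered by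
    the copy on [u x]. Each [x] concerns at most one [r]-subset, as [u x] and
    [v y] agree in at most [r] points, and each [r]-subset concerns at most one
    [x]; so at most ['C(k, r)] independent permutations are involved, and each
    is harmless with probability [1 - #|P| * 'C(k, r) / 'C(#|M|, r)]. *)
Lemma packing_improvement (M Q X : finType) k r (u v : X -> M -> Q) (P : {set {set M}}) :
  r <= k -> packing k r P ->
  (forall x y, x != y -> #|agreement (u x) (u y)| < r) ->
  (forall x y, x != y -> #|agreement (v x) (v y)| < r) ->
  (forall x y, #|agreement (u x) (v y)| <= r) ->
  exists (G : {set {set M * Q}}) (gain : nat),
    [/\ packing k r G, #|G| = #|X| * #|P| + gain &
     ('C(#|M|, r) - #|P| * 'C(k, r)) ^ 'C(k, r) * (#|X| * #|P|)
       <= 'C(#|M|, r) ^ 'C(k, r) * gain].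
Proof.
move=> rk pP ur vr uvr; have /packingP[Pk Pr] := pP.
set h := 'C(k, r); set W := 'C(#|M|, r).
pose ag (z : X * {set M}) x := z.2 :&: agreement (u x) (v z.1).
have agr z x : #|ag z x| <= r.
  by apply: leq_trans (uvr x z.1); apply/subset_leq_card/finset.subsetIr.
pose F := [set z : X * {set M} | z.2 \in P].
have cF : #|F| = #|X| * #|P|.
  by rewrite -cardsT -cardsX; apply: eq_card => -[x A]; rewrite !inE.
pose S z := [set x | #|ag z x| == r].
have cperm := card_perm_type M.
pose bad (T : {set M}) := [set s : {perm M} | s @: T \notin shadow r P].
have cbad (T : {set M}) : #|T| = r -> #|bad T| * W = (#|M|)`! * (W - #|P| * h).
  move=> cT; have Shr U : U \in shadow r P -> #|U| = r by rewrite inE => /andP[/eqP].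
  have := card_perm_shadow Shr cT; rewrite (card_shadow pP) -/W -/h.
  have : #|[set s : {perm M} | s @: T \in shadow r P]| + #|bad T| = (#|M|)`!.
    rewrite -cperm -(cardsC [set s : {perm M} | s @: T \in shadow r P]); congr (_ + _).
    by apply: eq_card => s; rewrite !inE.
  move: #|bad T| #|[set s : {perm M} | _]| => nB nA <- e.
  by rewrite mulnBr -e mulnDl addKn.
(* An empty packing gains nothing; otherwise [r]-sets exist and [W] is positive. *)
have [F0|[z0 z0F]] := finset.set_0Vmem F.
  have [pG cG] := lifted_packing rk pP ur.
  exists [set graph_over (u z.1) z.2 | z in [set z : X * {set M} | z.2 \in P]], 0; split => //.
    by rewrite addn0.
  by rewrite -cF F0 cards0 muln0.
have W0 : 0 < W.
  by rewrite bin_gt0 (leq_trans rk) //; move: z0F; rewrite inE => /Pk <-; exact: max_card.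
have [T0 T0r] : exists T0 : {set M}, #|T0| = r.
  have /card_gt0P[T0] : 0 < #|[set T : {set M} | #|T| == r]| by rewrite card_draws.
  by rewrite inE => /eqP; exists T0.
have [||||w hw] := @exists_good_choice X {perm M} _ h #|bad T0| F S (fun z x => bad (ag z x)).
- by rewrite cperm fact_gt0.
- move=> z; rewrite inE => zP; rewrite /h -(Pk _ zP) -cards_draws.
  rewrite -(card_in_imset (f := ag z)).
    apply/subset_leq_card/fintype.subsetP => _ /imsetP[x + ->].
    by rewrite !inE => ->; rewrite finset.subsetIl.
  move=> x y; rewrite !inE => /eqP cx /eqP cy exy.
  apply/eqP/negPn/negP => /ur; rewrite ltnNge => /negP[]; rewrite -cx.
  apply/subset_leq_card/fintype.subsetP => i ix; have iy := ix; rewrite exy in iy.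
  by move: ix iy; rewrite !inE => /andP[_ /eqP->] /andP[_ /eqP->].
- move=> z x _; rewrite inE => /eqP cz.
  by rewrite -(leq_pmul2r W0) !cbad.
- exact: max_card.
pose good := [set z in F | [forall x in S z, w x \in bad (ag z x)]].
pose f (z : bool * (X * {set M})) :=
  if z.1 then graph_over (v z.2.1) z.2.2 else graph_over (u z.2.1) (w z.2.1 @^-1: z.2.2).
pose Dm := [set z : bool * (X * {set M}) | if z.1 then z.2 \in good else z.2 \in F].
have cw x (A : {set M}) : #|w x @^-1: A| = #|A| by apply: card_preimset; apply: perm_inj.
(* A large intersection would be an [r]-set of the block covered by the copy. *)
have cross x y A B : A \in P -> (y, B) \in good ->
    #|graph_over (u x) (w x @^-1: A) :&: graph_over (v y) B| < r.
  move=> AP; rewrite inE => /andP[_ /forall_inP gB]; rewrite card_graph_overI ltnNge.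
  apply/negP => rle.
  have sub : w x @^-1: A :&: B :&: agreement (u x) (v y) \subset ag (y, B) x.
    by rewrite /ag /= -finset.setIA finset.subsetIr.
  have eag : w x @^-1: A :&: B :&: agreement (u x) (v y) = ag (y, B) x.
    by apply/eqP; rewrite eqEcard sub (leq_trans (agr _ _) rle).
  have cag : #|ag (y, B) x| = r by apply/eqP; rewrite eqn_leq agr -eag rle.
  have := gB x; rewrite !inE cag eqxx => /(_ isT) /negP[].
  rewrite card_imset ?cag ?eqxx /=; last exact: perm_inj.
  apply/exists_inP; exists A => //; apply/fintype.subsetP => _ /imsetP[i iag ->].
  by move: iag; rewrite -eag !inE => /andP[/andP[]].
have gF z : z \in good -> z \in F by rewrite inE => /andP[].
have DmP c z : ((c, z) \in Dm) = if c then z \in good else z \in F by rewrite inE.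
have [||pG cG] := @indexed_packing _ _ k r Dm f rk.
- move=> [[] [x A]]; rewrite DmP /f /= card_graph_over ?cw; last by rewrite inE => /Pk.
  by move/gF; rewrite inE => /Pk.
- move=> [[] [x A]] [[] [y B]]; rewrite !DmP /f /=.
  + move=> /gF + /gF; rewrite !inE /= => AP BP nxy; rewrite card_graph_overI.
    have [exy|nxy'] := eqVneq x y; last first.
      by apply: leq_ltn_trans (vr x y nxy'); apply/subset_leq_card/finset.subsetIr.
    rewrite exy agreement_refl; apply: Pr => //.
    by move: nxy; rewrite exy !xpair_eqE !eqxx.
  + by move=> xg; rewrite inE /= => BP _; rewrite finset.setIC; apply: cross.
  + by rewrite inE /= => AP yg _; apply: cross.
  + rewrite !inE /= => AP BP nxy; rewrite card_graph_overI.
    have [exy|nxy'] := eqVneq x y; last first.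
      by apply: leq_ltn_trans (ur x y nxy'); apply/subset_leq_card/finset.subsetIr.
    rewrite exy agreement_refl -preimsetI cw; apply: Pr => //.
    by move: nxy; rewrite exy !xpair_eqE !eqxx.
exists (f @: Dm), #|good|; split=> //.
  have inj c : injective (pair c : X * {set M} -> bool * (X * {set M})) by move=> z z' [].
  have DmE : Dm = pair false @: F :|: pair true @: good.
    apply/finset.setP => -[[] z]; rewrite finset.in_setU DmP (finset.mem_imset _ _ (inj _)).
      by rewrite orbC; case: imsetP => [[? _ []]|]; rewrite ?orbF.
    by case: (imsetP (D := mem good)) => [[? _ []]|]; rewrite ?orbF.
  have dD : [disjoint pair false @: F & pair true @: good].
    by apply/pred0P => z /=; apply/negP => /andP[/imsetP[z1 _ ->] /imsetP[]].
  by rewrite cG DmE -cF; move: dD; rewrite -leq_card_setU => /eqP ->; rewrite !card_imset.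
have := leq_mul (leqnn (W ^ h)) hw; rewrite cperm -/good cF.
rewrite mulnA -expnMn [W * _]mulnC cbad // expnMn.
by rewrite -mulnA [leqRHS]mulnCA leq_pmul2l // expn_gt0 fact_gt0.
Qed.

(** * Packing numbers *)

Definition packing_number (V : finType) (k r : nat) : nat :=
  \max_(P : {set {set V}} | packing k r P) #|P|.

Lemma packing_number_witness (V : finType) k r :
  exists2 P : {set {set V}}, packing k r P & #|P| = packing_number V k r.
Proof.
have [|P PP eP] := @eq_bigmax_cond _ [pred P : {set {set V}} | packing k r P] (fun P => #|P|).
  apply/card_gt0P; exists finset.set0; rewrite inE /=.
  by apply/packingP; split=> A; rewrite inE.
by exists P; rewrite // -eP.
Qed.

Lemma leq_packing_number (V : finType) k r (P : {set {set V}}) :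
  packing k r P -> #|P| <= packing_number V k r.
Proof. by move=> PP; apply: leq_bigmax_cond. Qed.

Lemma packing_number_leq (V W : finType) k r :
  #|V| = #|W| -> packing_number V k r <= packing_number W k r.
Proof.
move=> e; have [P /packingP[Pk Pr] <-] := packing_number_witness V k r.
pose f (x : V) : W := enum_val (cast_ord e (enum_rank x)).
have fI : injective f by move=> x y /enum_val_inj /cast_ord_inj /enum_rank_inj.
rewrite -(card_imset P (imset_inj fI)); apply: leq_packing_number.
apply/packingP; split=> [_ /imsetP[A AP ->]|_ _ /imsetP[A AP ->] /imsetP[B BP ->] nAB].
  by rewrite card_imset // Pk.
rewrite -imsetI; last by move=> x y _ _; apply: fI.
by rewrite card_imset // Pr //; apply: contraNneq nAB => ->.
Qed.

Lemma packing_number_bound (V : finType) k r :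
  packing_number V k r * 'C(k, r) <= 'C(#|V|, r).
Proof.
have [P PP <-] := packing_number_witness V k r.
rewrite -(card_shadow PP) -card_draws; apply/subset_leq_card/fintype.subsetP => T.
by rewrite !inE => /andP[].
Qed.

Lemma packing_number_gt0 (V : finType) k r : k <= #|V| -> 0 < packing_number V k r.
Proof.
move=> kV; have /card_gt0P[A] : 0 < #|[set A : {set V} | #|A| == k]|.
  by rewrite card_draws bin_gt0.
rewrite inE => /eqP Ak.
have : #|[set A]| <= packing_number V k r.
  apply: leq_packing_number; apply/packingP; split=> [B|B C]; rewrite !inE => /eqP-> //.
  by move=> /eqP->; rewrite eqxx.
by rewrite cards1.
Qed.

(** * Polynomial codes *)

Section PolynomialCodes.
Local Open Scope ring_scope.

Lemma unit_differences (M q : nat) (i j : 'I_M) :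
  (1 < q)%N -> coprime q M`! -> i != j ->
  (i%:R - j%:R : 'Z_q) \is a GRing.unit.
Proof.
move=> q1 cq; wlog ij : i j / (j < i)%N => [h|] nij.
  case: (ltngtP i j) => [lt|lt|e]; last by move: nij; rewrite (val_inj e) eqxx.
    by rewrite -opprB unitrN; apply: h => //; rewrite eq_sym.
  exact: h.
rewrite -natrB; last exact: ltnW.
rewrite unitZpE //; apply: coprime_dvdr cq; apply: dvdn_fact.
by rewrite subn_gt0 ij (leq_trans (leq_subr _ _) (ltnW (ltn_ord i))).
Qed.

(** Over the integers mod [q] a polynomial may have more roots than its degree;
    it has not among points whose differences are units. *)
Lemma few_roots (M q : nat) (p : {poly 'Z_q}) :
  (1 < q)%N -> coprime q M`! -> p != 0 ->
  (#|[set i : 'I_M | p.[i%:R] == 0%R]| < size p)%N.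
Proof.
move=> q1 cq p0; set A := [set i | _].
have := @max_ring_poly_roots _ p [seq (i%:R : 'Z_q) | i : 'I_M <- enum A] p0.
rewrite size_map -cardE; apply.
  by apply/allP => _ /mapP[i + ->]; rewrite mem_enum inE.
have := enum_uniq A; elim: (enum A) => //= i l IH /andP[il /IH ->]; rewrite andbT.
apply/allP => _ /mapP[j jl ->]; rewrite /diff_roots mulrC eqxx /=.
by apply: (unit_differences q1 cq); apply: contraNneq il => <-.
Qed.

(** Two words of the same code differ by a nonzero polynomial of degree less than
    [r], two words of different codes by a monic polynomial of degree [r]. *)
Lemma polynomial_codes (M q r : nat) : (1 < q)%N -> coprime q M`! ->
  exists u v : 'rV['Z_q]_r -> 'I_M -> 'Z_q,
  [/\ forall x y, x != y -> (#|agreement (u x) (u y)| < r)%N,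
      forall x y, x != y -> (#|agreement (v x) (v y)| < r)%N &
      forall x y, (#|agreement (u x) (v y)| <= r)%N].
Proof.
move=> q1 cq.
pose u (x : 'rV['Z_q]_r) (i : 'I_M) := (rVpoly x).[i%:R].
pose v (x : 'rV['Z_q]_r) (i : 'I_M) := (rVpoly x + 'X^r).[i%:R].
have same (x y : 'rV['Z_q]_r) : x != y ->
    (#|[set i : 'I_M | (rVpoly (x - y)).[i%:R] == 0%R]| < r)%N.
  move=> nxy; apply: leq_trans (few_roots q1 cq _) (size_poly _ _).
  by apply: contraNneq nxy => /(congr1 (@poly_rV _ r)); rewrite rVpolyK raddf0 => /eqP; rewrite subr_eq0.
exists u, v; split=> x y.
- move=> /same; apply: leq_trans; rewrite ltnS; apply/subset_leq_card/fintype.subsetP => i.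
  by rewrite !inE /u raddfB hornerD hornerN subr_eq0.
- move=> /same; apply: leq_trans; rewrite ltnS; apply/subset_leq_card/fintype.subsetP => i.
  by rewrite !inE /v raddfB !hornerD hornerN subr_eq0 => /eqP/addIr ->.
have sz : size (rVpoly y + 'X^r - rVpoly x : {poly 'Z_q}) = r.+1.
  rewrite addrAC addrC size_polyDl size_polyXn // ltnS.
  by rewrite -raddfB; apply: size_poly.
have := @few_roots M q (rVpoly y + 'X^r - rVpoly x) q1 cq.
rewrite -size_poly_gt0 sz => /(_ isT); rewrite ltnS; apply: leq_trans.
apply/subset_leq_card/fintype.subsetP => i.
by rewrite !inE /u /v !hornerD hornerN subr_eq0 eq_sym.
Qed.
End PolynomialCodes.

(** * Amplification and pairs of packings *)

Lemma packing_number_step M q k r : r <= k -> 1 < q -> coprime q M`! ->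
  exists gain, q ^ r * packing_number 'I_M k r + gain <= packing_number 'I_(M * q) k r /\
   ('C(M, r) - packing_number 'I_M k r * 'C(k, r)) ^ 'C(k, r) * (q ^ r * packing_number 'I_M k r)
      <= 'C(M, r) ^ 'C(k, r) * gain.
Proof.
move=> rk q1 cq; have [u [v [uu vv uv]]] := polynomial_codes r q1 cq.
have [P PP eP] := packing_number_witness 'I_M k r.
have [G [gain [GG cG hg]]] := packing_improvement rk PP uu vv uv.
have cq' : #|'Z_q| = q by rewrite card_ord Zp_cast.
have cX : #|'rV['Z_q]_r| = q ^ r by rewrite card_mx cq' mul1n.
move: hg cG; rewrite card_ord cX eP => hg cG; exists gain; split=> //.
rewrite -cG; apply: leq_trans (leq_packing_number GG) _.
by apply: packing_number_leq; rewrite card_prod !card_ord Zp_cast.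
Qed.

(** The same packing is copied onto all graphs of both codes; blocks from
    different codes meet in at most [r] points. *)
Lemma packing_pair M q k r : r <= k -> 1 < q -> coprime q M`! ->
  exists P1 P2 : {set {set 'I_M * 'Z_q}},
   [/\ packing k r P1, packing k r P2, #|P1| = q ^ r * packing_number 'I_M k r,
       #|P2| = q ^ r * packing_number 'I_M k r &
       forall A B, A \in P1 -> B \in P2 -> #|A :&: B| <= r].
Proof.
move=> rk q1 cq; have [u [v [uu vv uv]]] := polynomial_codes r q1 cq.
have [P PP eP] := packing_number_witness 'I_M k r.
have cX : #|'rV['Z_q]_r| = q ^ r by rewrite card_mx card_ord Zp_cast // mul1n.
have := lifted_packing rk PP uu; have := lifted_packing rk PP vv; rewrite cX eP /=.
move=> [p2 c2] [p1 c1]; do 2!eexists; split; [exact: p1|exact: p2|exact: c1|exact: c2|].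
move=> _ _ /imsetP[[x A] _ ->] /imsetP[[y B] _ ->]; rewrite card_graph_overI /=.
by apply: leq_trans (uv x y); apply/subset_leq_card/finset.subsetIr.
Qed.

(** * Distance families from packings *)

Lemma blow_up (V : finType) e n : #|V| * e <= n ->
  exists f : {set V} -> {set 'I_n},
    forall A B, #|symdiff (f A) (f B)| = #|symdiff A B| * e.
Proof.
move=> Ve; have Ve' : #|{: V * 'I_e}| <= n by rewrite card_prod card_ord.
pose g (z : V * 'I_e) : 'I_n := widen_ord Ve' (enum_rank z).
have g_inj : injective g by move=> x y /(congr1 val) /= /val_inj /enum_rank_inj.
exists (fun A => g @: finset.setX A [set: 'I_e]) => A B.
have -> : symdiff (g @: finset.setX A [set: 'I_e]) (g @: finset.setX B [set: 'I_e])
   = g @: finset.setX (symdiff A B) [set: 'I_e].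
  apply/finset.setP => y; rewrite in_symdiff.
  have [[[x j] ->]|no] := pselect (exists z, y = g z).
    by rewrite !finset.mem_imset // !finset.in_setX in_symdiff !inE !andbT.
  have no' C : y \in g @: finset.setX C [set: 'I_e] = false.
    by apply/negP => /imsetP[z _ ez]; apply: no; exists z.
  by rewrite !no'.
by rewrite card_imset // cardsX cardsT card_ord.
Qed.

Lemma blow_up_family (V : finType) e n (D : {pred nat}) (G : {set {set V}}) :
  0 < e -> #|V| * e <= n ->
  (forall A B, A \in G -> B \in G -> A != B -> #|symdiff A B| * e \in D) ->
  #|G| <= max_distance_family D n.
Proof.
move=> e0 /blow_up[f fE] GD.
have f_inj : injective f.
  move=> A B /eqP; rewrite -card_symdiff_eq0 fE muln_eq0 card_symdiff_eq0 (gtn_eqF e0) orbF.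
  by move/eqP.
rewrite -(card_imset G f_inj); apply: leq_max_distance_family.
move=> _ _ /imsetP[A AG ->] /imsetP[B BG ->] nAB; rewrite fE; apply: GD => //.
by apply: contraNneq nAB => ->.
Qed.

Lemma packing_distance_family (V : finType) e s t n (P : {set {set V}}) :
  0 < e -> s <= t.+1 -> packing t (t.+1 - s) P -> #|V| * e <= n ->
  #|P| <= max_distance_family [in dist_set (2 * e) s t] n.
Proof.
move=> e0 st /packingP[Pk Pr] Ve; apply: (blow_up_family e0 Ve) => A B AP BP nAB.
apply/dist_setP; exists (t - #|A :&: B|).
  by have := Pr A B AP BP nAB; lia.
have := card_symdiff A B; rewrite (Pk A AP) (Pk B BP).
have : #|A :&: B| <= t by rewrite -(Pk A AP); apply/subset_leq_card/finset.subsetIl.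
nia.
Qed.

(** The second packing receives the extra point [None], one more block of size
    [d], which adds [d] to every cross distance. This makes up for cross
    intersections that may reach [r]. *)
Lemma packing_pair_distance_family (V : finType) d s t n (P1 P2 : {set {set V}}) :
  0 < d -> s <= t -> odd s -> odd t ->
  packing t./2 ((t./2).+1 - uphalf s) P1 -> packing t./2 ((t./2).+1 - uphalf s) P2 ->
  (forall A B, A \in P1 -> B \in P2 -> #|A :&: B| <= (t./2).+1 - uphalf s) ->
  #|V|.+1 * d <= n ->
  #|P1| + #|P2| <= max_distance_family [in dist_set d s t] n.
Proof.
move=> d0 st so to /packingP[P1k P1r] /packingP[P2k P2r] P12 Vd.
have et : t = (2 * t./2).+1 by rewrite mul2n; have := odd_double_half t; rewrite to.
have es : s.+1 = 2 * uphalf s by rewrite uphalf_half so mul2n; have := odd_double_half s; rewrite so; lia.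
pose up (A : {set V}) : {set option V} := Some @: A.
have S_inj : injective (@Some V) by move=> x y [].
have mS (A : {set V}) x : (Some x \in up A) = (x \in A) by rewrite /up finset.mem_imset.
have mN (A : {set V}) : (None \in up A) = false by apply/negP => /imsetP[].
have up_sym (A B : {set V}) : symdiff (up A) (up B) = up (symdiff A B).
  by apply/finset.setP => -[x|]; rewrite in_symdiff ?mS ?mN ?in_symdiff.
have cup (A : {set V}) : #|up A| = #|A| by apply: card_imset.
pose top A := symdiff (up A) [set None].
have up_inj : injective up by apply: imset_inj.
have top_inj : injective top by move=> A B /(can_inj (symdiffK _)) /up_inj.
have top_sym (A B : {set V}) : #|symdiff (top A) (top B)| = #|symdiff A B|.
  by rewrite symdiff_shift up_sym cup.
have cross (A B : {set V}) : #|symdiff (up A) (top B)| = #|symdiff A B|.+1.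
  rewrite symdiffA up_sym card_symdiff_disjoint ?cards1 ?cup ?addn1 //.
  by apply/pred0P => -[x|] /=; rewrite !inE ?andbF // mN.
have mem_same (A B : {set V}) : #|A| = t./2 -> #|B| = t./2 -> #|A :&: B| < (t./2).+1 - uphalf s ->
    #|symdiff A B| * d \in dist_set d s t.
  move=> cA cB cAB; apply/dist_setP; exists #|symdiff A B| => //.
  by have := card_symdiff A B; rewrite cA cB; move: cAB; clear - et es; lia.
have mem_cross (A B : {set V}) : #|A| = t./2 -> #|B| = t./2 -> #|A :&: B| <= (t./2).+1 - uphalf s ->
    #|symdiff A B|.+1 * d \in dist_set d s t.
  move=> cA cB cAB; apply/dist_setP; exists #|symdiff A B|.+1 => //.
  by have := card_symdiff A B; rewrite cA cB; move: cAB; clear - et es st; lia.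
have dis : [disjoint up @: P1 & top @: P2].
  apply/pred0P => X /=; apply/negP => /andP[/imsetP[A _ ->] /imsetP[B _ e]].
  by have := cross A B; rewrite e; have /eqP := card_symdiff_eq0 (top B) (top B); rewrite eqxx => /eqP/eqP ->.
rewrite -(card_imset P1 up_inj) -(card_imset P2 top_inj).
move: dis; rewrite -leq_card_setU => /eqP <-.
apply: (blow_up_family d0); first by rewrite card_option; exact: Vd.
move=> X Y; rewrite !finset.in_setU => /orP[] /imsetP[A AP ->] /orP[] /imsetP[B BP ->] nAB.
- rewrite up_sym cup; apply: mem_same (P1k _ AP) (P1k _ BP) (P1r _ _ AP BP _).
  by apply: contraNneq nAB => ->.
- by rewrite cross; exact: mem_cross (P1k _ AP) (P2k _ BP) (P12 _ _ AP BP).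
- by rewrite symdiffC cross; exact: mem_cross (P1k _ BP) (P2k _ AP) (P12 _ _ BP AP).
rewrite top_sym; apply: mem_same (P2k _ AP) (P2k _ BP) (P2r _ _ AP BP _).
by apply: contraNneq nAB => ->.
Qed.

(** These multipliers have bounded gaps, so any large number is well approximated
    by [M * q]; primes would require information on their gaps. *)
Lemma coprime_multiplier M j : coprime (j * M`! + 1) M`!.
Proof. by rewrite coprime_sym /coprime gcdnMDl gcdn1. Qed.

Lemma fitting_multiplier M e : 0 < M -> 0 < e -> exists C, forall n, C < n ->
  exists q, [/\ 1 < q, coprime q M`!, M * q * e <= n & n <= M * q * e + C].
Proof.
move=> M0 e0; exists (e + M * e + M * e + M * M`! * e) => n nC.
(* The largest [q] congruent to 1 mod [M`!] with [M * q * e <= n]. *)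
pose m := n %/ (M * e); pose j := m.-1 %/ M`!.
have F0 := fact_gt0 M; have Me0 : 0 < M * e by rewrite muln_gt0 M0.
have h1 := divn_eq n (M * e); have h2 : n %% (M * e) < M * e by rewrite ltn_mod.
have h3 := divn_eq m.-1 M`!; have h4 : m.-1 %% M`! < M`! by rewrite ltn_mod.
rewrite -/m in h1; rewrite -/j in h3.
exists (j * M`! + 1); rewrite coprime_multiplier.
have m0 : 0 < m by rewrite divn_gt0 // ; lia.
have hl : j * M`! + 1 <= m by lia.
have hu : m <= j * M`! + 1 + M`! by lia.
have eM x : M * x * e = x * (M * e) by rewrite mulnAC mulnC.
rewrite !eM; have hl' := leq_mul hl (leqnn (M * e)); have hu' := leq_mul hu (leqnn (M * e)).
have eF : M * M`! * e = M`! * (M * e) by rewrite eM.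
rewrite mulnDl in hu'.
split=> //; last by lia.
  rewrite ltnNge; apply/negP => le1; have := leq_mul le1 (leqnn (M * e)).
  by lia.
by lia.
Qed.

(** * Packings of density close to one *)

Section NearOptimalPackings.
Local Open Scope ring_scope.

Lemma bernoulli_ge (R : realDomainType) (x : R) j : 0 <= x -> 1 + j%:R * x <= (1 + x) ^+ j.
Proof.
move=> x0; elim: j => [|j IH]; first by rewrite mul0r addr0 expr0.
rewrite exprS -natr1.
have h : (1 + x) * (1 + j%:R * x) <= (1 + x) * (1 + x) ^+ j by rewrite ler_wpM2l // addr_ge0.
apply: le_trans h; have j0 : 0 <= j%:R :> R by rewrite ler0n.
by nra.
Qed.

Lemma bernoulli_le (R : realDomainType) (x : R) j :
  0 <= x <= 1 -> 1 - j%:R * x <= (1 - x) ^+ j.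
Proof.
move=> /andP[x0 x1]; elim: j => [|j IH]; first by rewrite mul0r subr0 expr0.
rewrite exprS -natr1.
have h : (1 - x) * (1 - j%:R * x) <= (1 - x) * (1 - x) ^+ j by rewrite ler_wpM2l // subr_ge0.
apply: le_trans h; have j0 : 0 <= j%:R :> R by rewrite ler0n.
by nra.
Qed.

Lemma ffact_leq_expn M r : (M ^_ r <= M ^ r)%N.
Proof.
elim: r => // r IH; rewrite ffactnSr expnSr leq_mul //; exact: leq_subr.
Qed.

Lemma expn_leq_ffact M r : ((M - r) ^ r <= M ^_ r)%N.
Proof.
elim: r => // r IH; rewrite ffactnSr expnSr leq_mul //; last by rewrite leq_sub2l.
apply: leq_trans IH; case: r => // r; rewrite leq_exp2r // leq_sub2l //.
Qed.

Lemma ffact_lower (R : realFieldType) M r : (0 < M)%N ->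
  (1 - r%:R * (r%:R / M%:R)) * M%:R ^+ r <= (M ^_ r)%:R :> R.
Proof.
move=> M0; have M0' : 0 < M%:R :> R by rewrite ltr0n.
have [rM|Mr] := leqP r M; last first.
  rewrite ffact_small // nmulr_rle0 ?exprn_ge0 // subr_lt0 mulrA ltr_pdivlMr // mul1r.
  by rewrite -natrM ltr_nat; nia.
apply: (@le_trans _ _ ((M - r) ^ r)%:R); last by rewrite ler_nat expn_leq_ffact.
rewrite natrX natrB //.
have -> : M%:R - r%:R = (1 - r%:R / M%:R) * M%:R :> R.
  by rewrite mulrBl mul1r divfK // lt0r_neq0.
rewrite exprMn ler_wpM2r ?exprn_ge0 ?ler0n // bernoulli_le //.
by rewrite divr_ge0 ?ler0n //= ler_pdivrMr // mul1r ler_nat.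
Qed.

Lemma packing_number_ffact_bound M k r :
  (packing_number 'I_M k r * k ^_ r <= M ^ r)%N.
Proof.
rewrite -bin_ffact mulnA; apply: leq_trans (ffact_leq_expn M r).
by rewrite -bin_ffact leq_mul //; have := packing_number_bound 'I_M k r; rewrite card_ord.
Qed.

(** At least the proportion [b] of the asymptotic maximum
    [M ^ r / k ^_ r], written without division. *)
Definition packing_density_ge (R : numDomainType) (k r : nat) (b : R) (M : nat) :=
  (0 < M)%N /\ b * M%:R ^+ r <= (packing_number 'I_M k r * k ^_ r)%:R.

(** First multiply [M] until ['C(M1, r) * r`!] is close to [M1 ^ r], which does
    not decrease the density. Then the covered proportion of the [r]-sets is at
    most [1 - eta], and one amplification gains the factor [1 + eta ^+ h]. *)
Lemma packing_density_step (R : realType) k r (eps : R) : (r <= k)%N -> 0 < eps -> 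
  (forall M, ~ packing_density_ge k r (1 - eps) M) ->
  exists2 c : R, 0 < c & forall b M, 0 <= b ->
    packing_density_ge k r b M -> exists M', packing_density_ge k r (b * (1 + c)) M'.
Proof.
move=> rk e0 no.
have lt M : (0 < M)%N -> (packing_number 'I_M k r * k ^_ r)%:R < (1 - eps) * M%:R ^+ r.
  by move=> M0; rewrite ltNge; apply/negP => h; apply: (no M).
have e1 : eps < 1.
  have /(_ isT) h := lt 1%N; rewrite expr1n mulr1 in h.
  by rewrite -subr_gt0; apply: le_lt_trans h; rewrite ler0n.
have [M0 hM0] : exists M0 : nat, forall M, (M0 < M)%N -> r%:R * (r%:R / M%:R) <= eps / 2.
  exists (Num.bound (2 * r%:R * r%:R / eps)) => M hM.
  have M0 : 0 < M%:R :> R by rewrite ltr0n; case: M hM.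
  rewrite mulrA ler_pdivrMr // -ler_pdivrMl ?divr_gt0 //.
  have : 2 * r%:R * r%:R / eps <= M%:R.
    apply: le_trans (_ : _ <= (Num.bound (2 * r%:R * r%:R / eps))%:R) _.
      by apply/ltW/archi_boundP; rewrite !mulr_ge0 ?ler0n // invr_ge0 ltW.
    by rewrite ler_nat ltnW.
  have -> // : (eps / 2)^-1 * (r%:R * r%:R) = 2 * r%:R * r%:R / eps by field; rewrite lt0r_neq0.
(* [1 - eta = (1 - eps) / (1 - eps / 2)]: density below [1 - eps], relative to
   ['C(M1, r) * r`!] instead of [M1 ^ r]. *)
pose eta := (eps / 2) / (1 - eps / 2).
have d0 : 0 < 1 - eps / 2 by lra.
have eta0 : 0 < eta by rewrite divr_gt0 ?divr_gt0.
set h := 'C(k, r).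
exists (eta ^+ h); first by rewrite exprn_gt0.
move=> b M b0 [Mgt bM].
have grow N q g : (0 < N)%N -> (1 < q)%N -> (q ^ r * packing_number 'I_N k r + g <= packing_number 'I_(N * q) k r)%N ->
  ((q ^ r * packing_number 'I_N k r + g) * k ^_ r)%:R <= (packing_number 'I_(N * q) k r * k ^_ r)%:R :> R.
  by move=> N0 q1 le; rewrite ler_nat leq_mul2r le orbT.
have [M1 [M1gt bM1] M1M0] : exists2 M1, packing_density_ge k r b M1 & (M0 < M1)%N.
  pose q := (M0.+1 * M`! + 1)%N.
  have F0 := fact_gt0 M.
  have q1 : (1 < q)%N by rewrite /q; nia.
  have [g [hg _]] := packing_number_step rk q1 (coprime_multiplier M M0.+1).
  exists (M * q)%N; last by rewrite /q; nia.
  split; first by rewrite muln_gt0 Mgt; lia.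
  apply: le_trans (grow _ _ _ Mgt q1 hg).
  have : b * (M * q)%:R ^+ r <= (q ^ r * (packing_number 'I_M k r * k ^_ r))%:R.
    by rewrite natrM exprMn mulrA mulrC natrM natrX ler_wpM2l // exprn_ge0.
  by move/le_trans; apply; rewrite ler_nat mulnA leq_mul2r leq_addr orbT.
pose q := (1 * M1`! + 1)%N.
have q1 : (1 < q)%N by rewrite /q; have := fact_gt0 M1; lia.
have [g [hg gain]] := packing_number_step rk q1 (coprime_multiplier M1 1).
exists (M1 * q)%N; split; first by rewrite muln_gt0 M1gt; lia.
apply: le_trans (grow _ _ _ M1gt q1 hg).
set p := packing_number 'I_M1 k r in gain hg bM1 *.
set W := 'C(M1, r) in gain.
have fl := ffact_lower R r M1gt; have hh := hM0 _ M1M0.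
have M1r : 0 < M1%:R ^+ r :> R by rewrite exprn_gt0 // ltr0n.
have ff : (1 - eps / 2) * M1%:R ^+ r <= (M1 ^_ r)%:R :> R.
  by apply: le_trans fl; rewrite ler_wpM2r ?(ltW M1r) // lerB.
have rf : 0 < (r`!)%:R :> R by rewrite ltr0n fact_gt0.
have W0 : 0 < W%:R :> R.
  have : 0 < (M1 ^_ r)%:R :> R by apply: lt_le_trans ff; rewrite mulr_gt0.
  by rewrite -bin_ffact natrM pmulr_lgt0.
have pW : (p * h)%:R <= (1 - eta) * W%:R :> R.
  rewrite -(ler_pM2r rf) -mulrA -!natrM !bin_ffact -mulnA bin_ffact.
  apply: le_trans (ltW (lt _ M1gt)) _.
  have -> : 1 - eps = (1 - eta) * (1 - eps / 2).
    by rewrite /eta mulrBl mul1r divfK ?lt0r_neq0 //; lra.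
  rewrite -mulrA ler_wpM2l // /eta subr_ge0 ler_pdivrMr // mul1r; lra.
have gain' : eta ^+ h * (q ^ r * p)%:R <= g%:R :> R.
  have Wh : 0 < W%:R ^+ h :> R by rewrite exprn_gt0.
  rewrite -(ler_pM2l Wh).
  have gainR : ((W - p * h) ^ h * (q ^ r * p))%:R <= (W ^ h * g)%:R :> R by rewrite ler_nat.
  rewrite -natrX -natrM; apply: le_trans gainR.
  rewrite natrX mulrA -exprMn [in leRHS]natrM [in leRHS]natrX ler_wpM2r ?ler0n //.
  have We : 0 < W%:R * eta :> R by rewrite mulr_gt0.
  apply: lerXn2r; rewrite ?nnegrE ?ler0n ?(ltW We) //.
  have [le|lt'] := leqP (p * h)%N W; first by rewrite natrB //; lra.
  exfalso; have : W%:R < (p * h)%:R :> R by rewrite ltr_nat.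
  by lra.
have kr : 0 <= (k ^_ r)%:R :> R by rewrite ler0n.
apply: (@le_trans _ _ ((q ^ r * p)%:R * (1 + eta ^+ h) * (k ^_ r)%:R)); last first.
  rewrite [leRHS]natrM natrD; apply: ler_wpM2r => //; rewrite mulrDr mulr1 lerD2l mulrC; exact: gain'.
have -> : b * (1 + eta ^+ h) * (M1 * q)%:R ^+ r = (b * M1%:R ^+ r) * (q%:R ^+ r * (1 + eta ^+ h)).
  rewrite natrM [(M1%:R * q%:R) ^+ r]exprMn; move: (eta ^+ h) (M1%:R ^+ r) (q%:R ^+ r) => x y z; ring.
have -> : (q ^ r * p)%:R * (1 + eta ^+ h) * (k ^_ r)%:R = (p * k ^_ r)%:R * (q%:R ^+ r * (1 + eta ^+ h)) :> R.
  rewrite !natrM natrX; move: (eta ^+ h) (q%:R ^+ r) p%:R (k ^_ r)%:R => x y z w; ring.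
by rewrite ler_wpM2r // mulr_ge0 ?exprn_ge0 ?ler0n // addr_ge0 // exprn_ge0 // ltW.
Qed.

(** Densities are at most 1, so they cannot be multiplied by [1 + c] forever. *)
Lemma near_optimal_packing (R : realType) k r (eps : R) :
  (r <= k)%N -> 0 < eps -> exists M, packing_density_ge k r (1 - eps) M.
Proof.
move=> rk e0; have [//|no] := pselect (exists M, packing_density_ge k r (1 - eps) M); exfalso.
have [|c c0 step] := packing_density_step rk e0; first by move=> M h; apply: no; exists M.
pose b0 : R := ((k.+1)%:R ^+ r)^-1.
have b0gt : 0 < b0 by rewrite invr_gt0 exprn_gt0 // ltr0n.
have iter j : exists M, packing_density_ge k r (b0 * (1 + c) ^+ j) M.
  elim: j => [|j [M hM]].
    (* A single block on [k.+1] points starts the iteration. *)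
    exists k.+1; split=> //; rewrite expr0 mulr1 mulVf ?gt_eqF ?exprn_gt0 ?ltr0n //.
    rewrite ler1n muln_gt0 ffact_gt0 rk andbT.
    by apply: packing_number_gt0; rewrite card_ord.
  rewrite exprSr mulrA; apply: step hM.
  by rewrite mulr_ge0 ?ltW // exprn_gt0 // addr_gt0.
have le1 j : b0 * (1 + c) ^+ j <= 1.
  have [M [M0 hM]] := iter j.
  have Mr : 0 < M%:R ^+ r :> R by rewrite exprn_gt0 // ltr0n.
  rewrite -(ler_pM2r Mr) mul1r; apply: le_trans hM _.
  by rewrite -natrX ler_nat packing_number_ffact_bound.
pose j := Num.bound (b0 * c)^-1.
have bc : 0 < b0 * c by rewrite mulr_gt0.
have hj : (b0 * c)^-1 < j%:R by apply: archi_boundP; rewrite invr_ge0 ltW.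
have := le1 j; have := bernoulli_ge j (ltW c0) => h1 h2.
have h3 : b0 * (1 + j%:R * c) <= 1 by apply: le_trans h2; rewrite ler_pM2l.
have h4 : 1 < j%:R * (b0 * c) by rewrite -ltr_pdivrMr // div1r.
by move: h3; rewrite mulrDr mulr1 mulrCA; lra.
Qed.
End NearOptimalPackings.

(** * Lower bounds *)

Lemma prod_multiples e s t : 0 < s -> s <= t.+1 ->
  \prod_(s <= i < t.+1) (e * i) = e ^ (t.+1 - s) * t ^_ (t.+1 - s).
Proof.
move=> s0; elim: t => [|t IH] st.
  by have -> : s = 1; [lia|rewrite big_geq // subnn].
have [->|st'] := eqVneq s t.+2; first by rewrite big_geq // subnn.
have {}st : s <= t.+1 by lia.
rewrite big_nat_recr //= IH // [t.+2 - s]subSn // expnS ffactSS.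
by rewrite mulnACA [X in X * _]mulnC [X in _ * X]mulnC.
Qed.

Lemma sub_max_distance_family (D D' : {pred nat}) n :
  {subset D <= D'} -> max_distance_family D n <= max_distance_family D' n.
Proof.
move=> sD; apply: max_distance_family_leq => F /distance_familyP FD.
by apply: leq_max_distance_family => A B AF BF AB; apply/sD/FD.
Qed.

Section LowerBounds.
Local Open Scope ring_scope.

(** Scaling by [q] and by the block size [e] preserves the leading term; the
    rounding error [C] is a constant. *)
Lemma packing_density_scale (R : realType) k r e (eps : R) M q n C :
  (0 < eps < 1) -> packing_density_ge k r (1 - eps) M -> (C < n)%N -> (n <= M * q * e + C)%N ->
  (1 - eps) * ((n - C) ^ r)%:R <=
    (q ^ r * packing_number 'I_M k r * (e ^ r * k ^_ r))%:R :> R.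
Proof.
move=> /andP[e0 e1] [M0 hM] Cn nC.
have -> : (q ^ r * packing_number 'I_M k r * (e ^ r * k ^_ r) =
   (q * e) ^ r * (packing_number 'I_M k r * k ^_ r))%N by rewrite expnMn; lia.
apply: (@le_trans _ _ ((1 - eps) * ((M * q * e) ^ r)%:R)).
  apply: ler_wpM2l; first by lra.
  rewrite ler_nat; case: (r) => // r'; rewrite leq_exp2r //; lia.
rewrite -mulnA expnMn natrM natrX mulrA mulrC natrM ler_wpM2l //.
Qed.

Lemma even_lower_bound (R : realType) e s t (eps : R) :
  (0 < e)%N -> (0 < s)%N -> (s <= t.+1)%N -> 0 < eps < 1 -> exists C, forall n, (C < n)%N ->
  (1 - eps) * ((n - C) ^ (t.+1 - s))%:R <=
    (max_distance_family [in dist_set (2 * e) s t] n * (\prod_(s <= i < t.+1) (e * i)))%:R.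
Proof.
move=> e0 s0 st he; have rt : (t.+1 - s <= t)%N by lia.
have [M hM] := near_optimal_packing rt (proj1 (andP he)).
have [C hC] := fitting_multiplier (proj1 hM) e0; exists C => n Cn.
have [q [q1 cq le1 le2]] := hC n Cn.
apply: le_trans (packing_density_scale he hM Cn le2) _.
rewrite prod_multiples // ler_nat leq_mul2r; apply/orP; right.
have [P1 [_ [p1 _ <- _ _]]] := packing_pair rt q1 cq.
by apply: packing_distance_family p1 _ => //; rewrite card_prod !card_ord Zp_cast.
Qed.

Lemma odd_lower_bound (R : realType) d s t (eps : R) :
  (0 < d)%N -> (s <= t)%N -> odd s -> odd t -> 0 < eps < 1 -> 
  let r := ((t./2).+1 - uphalf s)%N in
  exists C, forall n, (C < n)%N ->
  (1 - eps) * (2 * (n - C) ^ r)%:R <=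
    (max_distance_family [in dist_set d s t] n * (\prod_(uphalf s <= i < (t./2).+1) (d * i)))%:R.
Proof.
move=> d0 st so to he r.
have s0 : (0 < uphalf s)%N by case: s so {st r}.
have st' : (uphalf s <= (t./2).+1)%N.
  rewrite uphalf_half so add1n ltnS; exact: half_leq.
have rt : (r <= t./2)%N by rewrite /r; lia.
have [M hM] := near_optimal_packing rt (proj1 (andP he)).
have [C hC] := fitting_multiplier (proj1 hM) d0; exists (C + d)%N => n Cn.
have Cn' : (C < n - d)%N by lia.
have [q [q1 cq le1 le2]] := hC (n - d)%N Cn'.
have := packing_density_scale he hM Cn' le2.
have -> : (n - d - C = n - (C + d))%N by lia.
have [P1 [P2 [p1 p2 c1 c2 c12]]] := packing_pair rt q1 cq.
have hV : (#|{: 'I_M * 'Z_q}|.+1 * d <= n)%N.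
  by rewrite card_prod !card_ord Zp_cast // mulSn; lia.
have := packing_pair_distance_family d0 st so to p1 p2 c12 hV.
rewrite c1 c2 addnn -mul2n => le3 le4.
rewrite prod_multiples // -/r natrM mulrCA.
apply: (@le_trans _ _ (2 * (q ^ r * packing_number 'I_M t./2 r * (d ^ r * t./2 ^_ r))%:R)).
  by rewrite ler_wpM2l.
by rewrite -natrM ler_nat mulnA leq_mul2r le3 orbT.
Qed.
End LowerBounds.

(** * Passing to the limit *)

Section Limits.
Local Open Scope ring_scope.
Local Open Scope classical_set_scope.

Lemma div_nat_cvg (R : realType) (a : R) : a / n%:R @[n --> \oo] --> (0 : R).
Proof.
rewrite -(mulr0 a); apply: cvgM; first exact: cvg_cst.
apply/gtr0_cvgV0; last exact: cvgr_idn.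
by near=> n; rewrite ltr0n; near: n; exact: nbhs_infty_gt.
Unshelve. all: by end_near. Qed.

Lemma exp_cvg (R : realType) (I : Type) (F : set_system I) (f : I -> R) (l : R) r :
  Filter F -> f x @[x --> F] --> l -> f x ^+ r @[x --> F] --> l ^+ r.
Proof.
move=> FF fl; elim: r => [|r IH].
  by under eq_fun do rewrite expr0; rewrite expr0; exact: cvg_cst.
by under eq_fun do rewrite exprS; rewrite exprS; exact: cvgM.
Qed.

Lemma one_plus_cvg (R : realType) (a : R) r : (1 + a / n%:R) ^+ r @[n --> \oo] --> (1 : R).
Proof.
have h : 1 + a / n%:R @[n --> \oo] --> (1 + 0 : R).
  by apply: cvgD; [exact: cvg_cst|exact: div_nat_cvg].
by have := @exp_cvg R _ _ _ _ r _ h; rewrite addr0 expr1n; apply.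
Qed.

(** An additive constant inside the power does not change the limit. *)
Lemma ratio_cvg (R : realType) (u : nat -> nat) (r p c : nat) :
  (0 < p)%N -> (0 < c)%N ->
  (exists C, forall n, (u n * p <= c * (n + C) ^ r)%N) ->
  (forall eps : R, 0 < eps < 1 -> exists C, forall n, (C < n)%N ->
     (1 - eps) * (c * (n - C) ^ r)%:R <= (u n * p)%:R) ->
  (u n)%:R / n%:R ^+ r @[n --> \oo] --> (c%:R / p%:R : R).
Proof.
move=> p0 c0 [C hC] low.
have pR : 0 < p%:R :> R by rewrite ltr0n.
have cR : 0 < c%:R :> R by rewrite ltr0n.
pose y n : R := (u n * p)%:R / (c%:R * n%:R ^+ r).
suff y1 : y n @[n --> \oo] --> (1 : R).
  have -> : (fun n => (u n)%:R / n%:R ^+ r) = (fun n => y n * (c%:R / p%:R)) :> (nat -> R).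
    apply/funext => n; rewrite /y natrM invfM.
    have : c%:R != 0 :> R by rewrite lt0r_neq0.
    have : p%:R != 0 :> R by rewrite lt0r_neq0.
    by move: (_ ^-1) => z ? ?; field; apply/andP.
  by have := cvgM y1 (cvg_cst (c%:R / p%:R : R)); rewrite mul1r; apply.
apply/cvgrPdist_le => eta eta0.
pose eps := Num.min (eta / 2) (1 / 2).
have he : 0 < eps < 1 by rewrite /eps lt_min gt_min; apply/andP; split; [apply/andP; split; lra|apply/orP; right; lra].
have he2 : eps <= eta / 2 by rewrite /eps ge_min lexx.
have [C' hC'] := low eps he.
have /cvgrPdist_le /(_ eps (proj1 (andP he))) up := one_plus_cvg (C%:R : R) r.
have /cvgrPdist_le /(_ eps (proj1 (andP he))) dn := one_plus_cvg (- C'%:R : R) r.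
near=> n.
have nC' : (C' < n)%N by near: n; exact: nbhs_infty_gt.
have n0 : (0 < n)%N by case: (n) nC'.
have nR : 0 < n%:R :> R by rewrite ltr0n.
have nr : 0 < c%:R * n%:R ^+ r :> R by rewrite mulr_gt0 ?exprn_gt0.
have upn : `|1 - (1 + C%:R / n%:R) ^+ r| <= eps :> R by near: n.
have dnn : `|1 - (1 + - C'%:R / n%:R) ^+ r| <= eps :> R by near: n.
have yu : y n <= (1 + C%:R / n%:R) ^+ r.
  rewrite /y ler_pdivrMr // mulrCA -exprMn mulrDl mul1r divfK ?lt0r_neq0 //.
  by rewrite -natrD -natrX -natrM ler_nat.
have yl : (1 - eps) * (1 + - C'%:R / n%:R) ^+ r <= y n.
  have ex : (1 + - C'%:R / n%:R) * n%:R = (n - C')%:R :> R.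
    rewrite natrB; last exact: ltnW.
    by rewrite mulrDl mul1r divfK // lt0r_neq0.
  have e2 (a b z w : R) : a * b * (z * w) = a * (z * (b * w)) by ring.
  by rewrite /y ler_pdivlMr // e2 -exprMn ex -natrX -natrM; apply: hC'.
move: upn dnn; rewrite !ler_norml => /andP[u1 u2] /andP[d1 d2].
move/andP: he => [e0 e1].
apply/andP; split; first by lra.
by nra.
Unshelve. all: by end_near. Qed.

Lemma asymp_eq_of_ratio (R : realType) (u v : nat -> R) r (l : R) : l != 0 ->
  u n / n%:R ^+ r @[n --> \oo] --> l -> v n / n%:R ^+ r @[n --> \oo] --> l ->
  asymp_eq u v.
Proof.
move=> l0 ul vl; exists (fun n => (u n / n%:R ^+ r) / (v n / n%:R ^+ r) - 1); split.
  rewrite -(subrr (1 : R)) -[X in X - 1](divff l0).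
  by apply: cvgB; [apply: cvgM ul _; apply: cvgV|exact: cvg_cst].
have vn0 : \forall n \near \oo, v n / n%:R ^+ r != 0 by exact: (cvgr_neq0 l vl l0).
near=> n; have vn : v n / n%:R ^+ r != 0 by near: n.
have n0 : n%:R ^+ r != 0 :> R.
  by apply/expf_neq0; rewrite pnatr_eq0 -lt0n; near: n; exact: nbhs_infty_gt.
have v0 : v n != 0 by apply: contraNneq vn => ->; rewrite mul0r.
by field; rewrite v0 n0.
Unshelve. all: by end_near. Qed.

Lemma rbinom_cvg (R : realType) (a b : R) k :
  a * rbinom (b * n%:R) k / n%:R ^+ k @[n --> \oo] --> a * (b ^+ k / (k`!)%:R).
Proof.
have h : (\prod_(i < k) (b - i%:R / n%:R)) @[n --> \oo] --> b ^+ k.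
  elim: k => [|k IH].
    by under eq_fun do rewrite big_ord0; rewrite expr0; exact: cvg_cst.
  under eq_fun do rewrite big_ord_recr /=; rewrite exprSr; apply: cvgM => //.
  by have := cvgB (cvg_cst b) (div_nat_cvg k%:R); rewrite subr0; apply.
have h2 : a * ((\prod_(i < k) (b - i%:R / n%:R)) / (k`!)%:R) @[n --> \oo] --> a * (b ^+ k / (k`!)%:R).
  exact: cvgM (cvg_cst _) (cvgM h (cvg_cst _)).
apply: cvg_trans h2; apply: near_eq_cvg; near=> n.
have n0 : n%:R != 0 :> R by rewrite pnatr_eq0 -lt0n; near: n; exact: nbhs_infty_gt.
rewrite /rbinom -!mulrA; congr (_ * _); rewrite [RHS]mulrCA mulrC; congr (_ * _).
rewrite -[in X in _ / X](card_ord k) -prodr_const -prodf_div; apply: eq_bigr => i _.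
by rewrite mulrBl mulfK.
Unshelve. all: by end_near. Qed.

Lemma rbinom_nat (R : realType) t k : (k <= t)%N ->
  rbinom (t%:R : R) k = (t ^_ k)%:R / (k`!)%:R.
Proof.
move=> kt; rewrite /rbinom; congr (_ / _).
elim: k kt => [|k IH] kt; first by rewrite big_ord0.
by rewrite big_ord_recr /= (IH (ltnW kt)) ffactnSr natrM (natrB _ (ltnW kt)).
Qed.

Lemma card_dist_set d s t : (0 < d)%N -> #|` dist_set d s t|%fset = (t.+1 - s)%N.
Proof.
move=> d0; rewrite card_imfset /=; last first.
  by move=> i j /eqP; rewrite eqn_pmul2r // => /eqP.
by rewrite undup_id ?iota_uniq // size_iota.
Qed.

Lemma even_part_of_even d s t : ~~ odd d -> even_part (dist_set d s t) = dist_set d s t.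
Proof.
move=> dev; apply/fsetP => x; rewrite !inE /=.
have [xD|] //= := boolP (x \in dist_set d s t).
by move/dist_setP: xD => [i _ ->]; rewrite oddM (negbTE dev) andbF.
Qed.

Lemma half_dist_set d s t : odd d ->
  {subset dist_set (2 * d) (uphalf s) t./2 <= dist_set d s t}.
Proof.
move=> dodd x /dist_setP[i /andP[si it] ->]; apply/dist_setP; exists (2 * i)%N; last by lia.
rewrite mul2n -leq_uphalf_double si /=; apply: leq_trans (_ : t./2.*2 <= t)%N.
  by rewrite leq_double.
by rewrite -{2}(odd_double_half t) leq_addl.
Qed.

Lemma even_part_of_odd d s t : odd d ->
  even_part (dist_set d s t) = dist_set (2 * d) (uphalf s) t./2.
Proof.
move=> dodd; apply/fsetP => x; rewrite !inE /=; apply/andP/idP => [[xD ox]|xD].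
  exact: dist_set_even_part.
split; first exact: half_dist_set.
by move/dist_setP: xD => [i _ ->]; rewrite oddM oddM andbF.
Qed.
End Limits.

(** * The asymptotic formulas *)

(** Both sides are [c / p * n ^ r * (1 + o(1))], as [p = e ^ r * t ^_ r]. *)
Lemma asymp_eq_rbinom (R : realType) (u : nat -> nat) (e s t c : nat) :
  0 < e -> 0 < s -> s <= t.+1 -> 0 < c ->
  let r := t.+1 - s in
  let p := \prod_(s <= i < t.+1) (e * i) in
  (exists C, forall n, u n * p <= c * (n + C) ^ r) ->
  (forall eps : R, (0 < eps < 1)%R -> exists C, forall n, C < n ->
     ((1 - eps) * (c * (n - C) ^ r)%:R <= (u n * p)%:R)%R) ->
  asymp_eq (fun n => (u n)%:R : R)%R
    (fun n => c%:R / rbinom t%:R r * rbinom (n%:R / e%:R) r)%R.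
Proof.
move=> e0 s0 st c0 r p up low.
have rt : r <= t by rewrite /r; lia.
have pE : p = e ^ r * t ^_ r by rewrite /p prod_multiples.
have p0 : 0 < p by rewrite pE muln_gt0 expn_gt0 e0 ffact_gt0.
have pR : (p%:R != 0 :> R)%R by rewrite pnatr_eq0 -lt0n.
have cR : (c%:R != 0 :> R)%R by rewrite pnatr_eq0 -lt0n.
apply: (asymp_eq_of_ratio (r := r) (l := (c%:R / p%:R)%R)).
- by rewrite mulf_neq0 // invr_neq0.
- exact: ratio_cvg.
have := @rbinom_cvg R (c%:R / rbinom t%:R r)%R (e%:R^-1)%R r.
have -> : (c%:R / rbinom t%:R r * (e%:R^-1 ^+ r / r`!%:R) = c%:R / p%:R :> R)%R.
  rewrite rbinom_nat // pE natrM natrX exprVn.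
  have fR : ((r`!)%:R != 0 :> R)%R by rewrite pnatr_eq0 -lt0n fact_gt0.
  have eR : (e%:R ^+ r != 0 :> R)%R by rewrite expf_neq0 // pnatr_eq0 -lt0n.
  have tR : ((t ^_ r)%:R != 0 :> R)%R by rewrite pnatr_eq0 -lt0n ffact_gt0.
  by field; rewrite fR eR tR.
by under eq_fun do rewrite [(e%:R^-1 * _)%R]mulrC; apply.
Qed.

Lemma even_asymp (R : realType) e s t : 0 < e -> 0 < s -> s <= t ->
  asymp_eq (fun n => (max_distance_family [in dist_set (2 * e) s t] n)%:R : R)%R
    (fun n => 1 / rbinom t%:R (t.+1 - s) * rbinom (n%:R / e%:R) (t.+1 - s))%R.
Proof.
move=> e0 s0 st; have st' : s <= t.+1 by lia.
apply: (@asymp_eq_rbinom R _ e s t 1) => //.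
  by have [C hC] := even_distance_bound e0 s0 st'; exists C => n; rewrite mulnC mul1n.
move=> eps he; have [C hC] := even_lower_bound e0 s0 st' he; exists C => n Cn.
by rewrite mul1n; apply: hC.
Qed.

(** The error term of [odd_distance_bound1] has degree [r - 1] and is absorbed by
    enlarging the constant inside the power. *)
Lemma odd_upper_bound d s t : odd d -> 0 < s -> s <= t -> ~~ odd (s * t) ->
  exists C, forall n,
    max_distance_family [in dist_set d s t] n * (\prod_(uphalf s <= i < (t./2).+1) (d * i))
      <= (n + C) ^ ((t./2).+1 - uphalf s).
Proof.
move=> dodd s0 st stev; have d0 : 0 < d by case: d dodd.
have s2 : 0 < uphalf s by case: s s0 {st stev}.
have st2 : uphalf s <= t./2.
  rewrite -(doubleK (uphalf s)); apply: half_leq.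
  move: stev; rewrite oddM negb_and uphalf_half doubleD => /orP[sev|tev].
    by rewrite (negbTE sev) add0n; have := odd_double_half s; rewrite (negbTE sev); lia.
  have := odd_double_half s; have := odd_double_half t; rewrite (negbTE tev); case: (odd s) => /=; lia.
have t2 : 0 < t./2 by lia.
have [C hC] := odd_distance_bound1 dodd s0 st stev.
have [C1 hC1] := @even_distance_bound d (uphalf s) t./2 d0 s2 (leqW st2).
have [|C2 hC2] := @even_distance_bound d (uphalf s) (t./2).-1 d0 s2; first by rewrite prednK.
rewrite prednK // in hC2; rewrite subSn //.
set r := t./2 - uphalf s in hC2 *.
set p := \prod_(uphalf s <= i < (t./2).+1) (d * i) in hC1 *.
set p' := \prod_(uphalf s <= i < t./2) (d * i) in hC2.
have p'0 : 0 < p'.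
  by rewrite /p' big_seq prodn_cond_gt0 // => i; rewrite mem_index_iota muln_gt0 d0 => /andP[/(leq_trans s2) ->].
exists (C1 + C2 + p * C) => n.
have h := hC n; have h1 := hC1 n; have h2 := hC2 n; rewrite subSn // -/r in h1.
move: h h1 h2; set f := max_distance_family _ _; set g := max_distance_family _ _.
set g' := max_distance_family _ _ => h h1 h2.
have h3 : g' <= (n + C2) ^ r by apply: leq_trans h2; rewrite leq_pmull.
have mono a b k : a <= b -> a ^ k <= b ^ k by move=> ab; case: k => // k; rewrite leq_exp2r.
set N := n + (C1 + C2 + p * C).
have m1 : (n + C1) ^ r <= N ^ r by apply: mono; rewrite /N; lia.
have m2 : (n + C2) ^ r <= N ^ r by apply: mono; rewrite /N; lia.
apply: leq_trans (_ : (n + C1) * N ^ r + (p * C) * N ^ r <= _); last first.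
  by rewrite -mulnDl expnS leq_mul2r /N; apply/orP; right; lia.
apply: leq_trans (leq_mul h (leqnn p)) _; rewrite mulnDl; apply: leq_add.
  by rewrite mulnC; apply: leq_trans h1 _; rewrite expnS leq_mul2l m1 orbT.
by rewrite mulnC mulnA leq_mul2l (leq_trans h3 m2) orbT.
Qed.

Lemma odd_asymp (R : realType) d s t : odd d -> 0 < s -> s <= t ->
  let c : R := (if odd (s * t) then 2 else 1)%R in
  let r := (t./2).+1 - uphalf s in
  asymp_eq (fun n => (max_distance_family [in dist_set d s t] n)%:R : R)%R
    (fun n => c / rbinom (t./2)%:R r * rbinom (n%:R / d%:R) r)%R.
Proof.
move=> dodd s0 st c r; have d0 : 0 < d by case: d dodd {r c}.
have s2 : 0 < uphalf s by case: s s0 {st r c}.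
have st2 : uphalf s <= (t./2).+1.
  by rewrite uphalf_half; have := half_leq st; case: (odd s); lia.
have -> : c = ((if odd (s * t) then 2 else 1)%N)%:R%R by rewrite /c; case: odd.
case: (boolP (odd (s * t))) => st_par; apply: (@asymp_eq_rbinom R _ d (uphalf s) t./2) => //.
- have [C hC] := even_distance_bound d0 s2 st2; exists C => n.
  rewrite mulnC; apply: leq_trans (leq_mul (leqnn _) (odd_distance_bound2 s t n dodd)) _.
  by rewrite mulnCA leq_mul2l hC.
- move=> eps he; move: st_par; rewrite oddM => /andP[so to].
  exact: odd_lower_bound.
- by have [C hC] := odd_upper_bound dodd s0 st st_par; exists C => n; rewrite mul1n.
move=> eps he; have [C hC] := even_lower_bound d0 s2 st2 he; exists C => n Cn.
rewrite mul1n; apply: le_trans (hC n Cn) _; rewrite ler_nat leq_mul2r; apply/orP; right.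
by apply: sub_max_distance_family => x; apply: half_dist_set.
Qed.

Local Open Scope ring_scope.

(* In (2), (t./2).+1 - uphalf s is |_t/2_| - |^s/2^| + 1 with the successor
   taken first: the value is 0 when s = t is odd, where truncated subtraction
   would otherwise give 1. *)
Theorem theorem1p1 (R : realType) (d s t : nat)
    (hd : (0 < d)%N) (hs : (1 <= s)%N) (hst : (s <= t)%N) :
  let D := dist_set d s t in
  let k := #|` even_part D|%fset in
  let f := fun n : nat => (max_distance_family [in D] n)%:R : R in
  (~~ odd d ->
     asymp_eq f (fun n : nat =>
       1 / rbinom t%:R k * rbinom (2 * n%:R / d%:R) k)
     /\
     asymp_eq f (fun n : nat =>
       1 / rbinom t%:R (t - s + 1)%N
         * rbinom (2 * n%:R / d%:R) (t - s + 1)%N))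
  /\
  (odd d ->
     let c : R := if odd (s * t)%N then 2 else 1 in
     let m := ((t./2).+1 - uphalf s)%N in
     asymp_eq f (fun n : nat =>
       c / rbinom (t./2)%:R k * rbinom (n%:R / d%:R) k)
     /\
     asymp_eq f (fun n : nat =>
       c / rbinom (t./2)%:R m * rbinom (n%:R / d%:R) m)).
Proof.
move=> D k f; split=> [dev|dodd c m]; last first.
  have -> : k = m by rewrite /k /D even_part_of_odd // card_dist_set // muln_gt0 hd.
  by split; apply: odd_asymp.
have -> : k = (t - s + 1)%N by rewrite /k /D even_part_of_even // card_dist_set // subSn // addn1.
suff h : asymp_eq f (fun n : nat =>
    1 / rbinom t%:R (t - s + 1)%N * rbinom (2 * n%:R / d%:R) (t - s + 1)%N) by [].
have dE : d = (2 * d./2)%N by rewrite mul2n; have := odd_double_half d; rewrite (negbTE dev).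
have e0 : (0 < d./2)%N by lia.
have := even_asymp R e0 hs hst; rewrite -dE subSn // -addn1.
congr asymp_eq; apply/funext => n; congr (_ * rbinom _ _).
rewrite [in RHS]dE natrM; field.
by rewrite pnatr_eq0 -lt0n.
Qed.
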